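(* For every positive integer $n$, $\mathcal{Q}(n)=\mathcal{Q}'(n)$. In other words, a non-negative Hermitian symmetric polynomial $r$ in $n$ complex variables is a quotient of squared norms of holomorphic polynomial mappings if and only if there exist a non-negative Hermitian symmetric polynomial $s$, not identically $0$, and a holomorphic polynomial mapping $F$ with $r s=\|F\|^2$.
   Context: A Hermitian symmetric polynomial in $n$ variables is a polynomial $r(z,\overline{w})=\sum_{\alpha,\beta} c_{\alpha\beta} z^\alpha \overline{w}^\beta$ on $\mathbb{C}^n\times\mathbb{C}^n$ with $c_{\alpha\beta}=\overline{c_{\beta\alpha}}$ (equivalently $r(z,\overline z)$ is real for all $z$). A holomorphic polynomial mapping is a map $\mathbb{C}^n\to\mathbb{C}^N$ (some finite $N$) whose components are holomorphic polynomials; $\|F(z)\|^2=\sum_j |F_j(z)|^2$. $\mathcal{P}_1(n)$ is the set of Hermitian symmetric polynomials $r$ in $n$ variables with $r(z,\overline z)\ge 0$ for all $z$. $\mathcal{Q}(n)$ is the set of Hermitian symmetric polynomials $r$ for which there are holomorphic polynomial mappings $F,G$ with $G$ not identically zero and $r(z,\overline z)=\|F(z)\|^2/\|G(z)\|^2$. $\mathcal{Q}'(n)$ is the set of $r\in\mathcal{P}_1(n)$ for which there exist $s\in\mathcal{P}_1(n)$, not identically $0$, and a holomorphic polynomial mapping $F$ with $r(z,\overline z)s(z,\overline z)=\|F(z)\|^2$. *)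

(* Defs.v *)
From HB Require Import structures.
From mathcomp Require Import all_boot all_order all_algebra.
From mathcomp Require Import reals complex mpoly.
Set Implicit Arguments. Unset Strict Implicit. Unset Printing Implicit Defensive.
Import Order.TTheory GRing.Theory Num.Theory.
Local Open Scope ring_scope.

Notation Cx R := (R[i])%type.

(* A polynomial r(z, wbar) on C^n x C^n is represented as an element of
   {mpoly C[n + n]}: variables 0..n-1 are z_1..z_n, variables n..2n-1 are
   wbar_1..wbar_n. *)

Definition swap_ord (n : nat) (i : 'I_(n + n)) : 'I_(n + n) :=
  match split i with
  | inl j => rshift n j
  | inr j => lshift n j
  end.

Definition swap_mnm (n : nat) (m : 'X_{1..n + n}) : 'X_{1..n + n} :=
  [multinom m (swap_ord i) | i < n + n].

Definition hermitian_symmetric (R : realType) (n : nat)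
    (r : {mpoly Cx R[n + n]}) : Prop :=
  forall m : 'X_{1..n + n}, r@_m = (r@_(swap_mnm m))^*.

Definition diag_pt (R : realType) (n : nat) (z : 'I_n -> Cx R) :
    'I_(n + n) -> Cx R :=
  fun i => match split i with inl j => z j | inr j => (z j)^* end.

Definition heval (R : realType) (n : nat) (r : {mpoly Cx R[n + n]})
    (z : 'I_n -> Cx R) : Cx R := r.@[diag_pt z].

(* A holomorphic polynomial mapping C^n -> C^N is a finite list (of length N)
   of holomorphic polynomials in n variables; ||F(z)||^2 = sum_j |F_j(z)|^2. *)
Definition sqnorm (R : realType) (n : nat) (F : seq {mpoly Cx R[n]})
    (z : 'I_n -> Cx R) : Cx R :=
  \sum_(f <- F) `|f.@[z]| ^+ 2.

Definition inP1 (R : realType) (n : nat) (r : {mpoly Cx R[n + n]}) : Prop :=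
  hermitian_symmetric r /\ forall z : 'I_n -> Cx R, 0 <= heval r z.

Definition inQ (R : realType) (n : nat) (r : {mpoly Cx R[n + n]}) : Prop :=
  hermitian_symmetric r /\
  exists F G : seq {mpoly Cx R[n]},
    has (fun g => g != 0) G /\
    forall z : 'I_n -> Cx R, sqnorm G z != 0 ->
      heval r z = sqnorm F z / sqnorm G z.

Definition inQ' (R : realType) (n : nat) (r : {mpoly Cx R[n + n]}) : Prop :=
  inP1 r /\
  exists (s : {mpoly Cx R[n + n]}) (F : seq {mpoly Cx R[n]}),
    inP1 s /\ s != 0 /\
    forall z : 'I_n -> Cx R, heval r z * heval s z = sqnorm F z.

(* Main.v *)
Require Import Defs.
From mathcomp Require Import all_boot all_order all_algebra.
From mathcomp Require Import reals complex mpoly.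
From mathcomp Require Import generic_quotient spectral polyrcf.
From mathcomp Require Import ring lra zify boolp classical_sets.
Set Implicit Arguments. Unset Strict Implicit. Unset Printing Implicit Defensive.
Import Order.TTheory GRing.Theory Num.Theory.
Local Open Scope ring_scope.

(* The inclusion of Q in Q' is a density argument.  For the converse let
   r s = |F|^2 with r, s >= 0 and suppose that r is not a quotient of squared
   norms.  Zorn's lemma gives a maximal cone M of Hermitian polynomials that
   contains -r, is stable under multiplication by squared norms and contains no
   opposite of a nonzero squared norm.  M totally orders the Hermitian
   polynomials, and comparing |h|^2 with eps |g|^2 in this order defines a place
   of C(z) with residue field C.  Diagonalise r = sum_i d_i |h_i|^2 with
   independent h_i; evaluating at the place, -r in M says that the form
   sum_i d_i |u_i|^2 is <= 0 at the residue u of the normalised vector (h_i).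

   On the other hand this form vanishes at no residue vector, at this or at any
   other place: polarising r s = |F|^2 and taking residues in one variable and
   then in the other shows that its product with the form of s is a nonzero
   squared norm.  Deform the generic point z to z + t a.  The coefficients of
   h_i (z + t a) in t have a Newton polygon; along each edge the residue is a
   polynomial vector in one complex variable on which the form has no zero
   outside a finite set, so the form has the same sign at both ends of the edge.
   At t = oo the form is >= 0 because r >= 0, hence it is > 0 at t = 0, that is
   at u: a contradiction. *)

(** * Places and their extensions to monomials *)

(** A maximal cone is only known to absorb products with sums of squared norms, so it cannot be used
    like a ring ordering; every multiplicative argument about the place has to pass through squared
    norms.

    The cone gives information at the generic point, while [r >= 0] is an assumption about points of
    C^n. The line [z + t a] links the two: its coefficients at the top power of [t] are values of
    homogeneous parts at the constant direction [a].

    Residues have to be complex numbers, because the non-vanishing argument conjugates them and uses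
    them again as coefficients of polynomials.

    Value groups are never formed: the sign of [e v(x) + k v(pi)] is read off from whether
    [x ^+ e * pi ^ k] is infinitesimal, a unit or not integral. *)

Record place (C K : fieldType) (iota : {rmorphism C -> K}) := Place {
  val_ring : K -> Prop;
  residue : K -> C;
  val_ring_iota : forall c, val_ring (iota c);
  val_ringD : forall x y, val_ring x -> val_ring y -> val_ring (x + y);
  val_ringM : forall x y, val_ring x -> val_ring y -> val_ring (x * y);
  residue_iota : forall c, residue (iota c) = c;
  residueD : forall x y, val_ring x -> val_ring y ->
    residue (x + y) = residue x + residue y;
  residueM : forall x y, val_ring x -> val_ring y ->
    residue (x * y) = residue x * residue y;
  val_ring_total : forall x,
    val_ring x \/ (val_ring x^-1 /\ residue x^-1 = 0) }.

Section Place.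
Variables (C K : fieldType) (iota : {rmorphism C -> K}) (P : place iota).
Local Notation O := (val_ring P).
Local Notation res := (residue P).

Definition infinitesimal x := O x /\ res x = 0.
(** As [0^-1 = 0], the element 0 satisfies this predicate; hence the assumptions [x != 0] that
    accompany it below. *)
Definition val_unit x := O x /\ O x^-1.
Local Notation Inf := infinitesimal.
Local Notation U := val_unit.

Lemma val_ring0 : O 0. Proof. by rewrite -(rmorph0 iota); apply: val_ring_iota. Qed.
Lemma val_ring1 : O 1. Proof. by rewrite -(rmorph1 iota); apply: val_ring_iota. Qed.
Lemma residue0 : res 0 = 0. Proof. by rewrite -(rmorph0 iota) residue_iota. Qed.
Lemma residue1 : res 1 = 1. Proof. by rewrite -(rmorph1 iota) residue_iota. Qed.
Lemma infinitesimal0 : Inf 0. Proof. by split; [exact: val_ring0|exact: residue0]. Qed.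

Lemma infinitesimal1 : ~ Inf 1.
Proof. by case=> _ /eqP; rewrite residue1 oner_eq0. Qed.

Lemma infinitesimalMl x y : O x -> Inf y -> Inf (x * y).
Proof.
by move=> Ox [Oy ry]; split; [exact: val_ringM|rewrite residueM // ry mulr0].
Qed.

Lemma infinitesimalMr x y : Inf x -> O y -> Inf (x * y).
Proof. by move=> Ix Oy; rewrite mulrC; apply: infinitesimalMl. Qed.

Lemma val_ringX x k : O x -> O (x ^+ k).
Proof.
move=> Ox; elim: k => [|k IH]; first by rewrite expr0; apply: val_ring1.
by rewrite exprS; apply: val_ringM.
Qed.

Lemma infinitesimalX x k : (0 < k)%N -> Inf x -> Inf (x ^+ k).
Proof.
by case: k => // k _ Ix; rewrite exprS; apply: infinitesimalMr => //; apply: val_ringX; case: Ix.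
Qed.

Lemma val_ring_cases x : Inf x \/ U x \/ (x != 0 /\ Inf x^-1).
Proof.
have [->|x0] := eqVneq x 0; first by left; apply: infinitesimal0.
have [Ox|Ix] := val_ring_total P x; last by right; right.
have [rx|rx] := eqVneq (res x) 0; first by left.
right; left; split=> //.
have [//|] := val_ring_total P x^-1; rewrite invrK => -[_ r0].
by rewrite r0 eqxx in rx.
Qed.

Lemma val_ring_infV x : Inf x^-1 -> x != 0 -> ~ O x.
Proof.
move=> Ix x0 Ox; apply: infinitesimal1; rewrite -(mulVf x0).
exact: infinitesimalMr.
Qed.

Lemma val_unit_neq0 x : U x -> x != 0 -> res x != 0.
Proof.
move=> [Ox Ox'] x0; apply/eqP => r0.
by apply: infinitesimal1; rewrite -(mulfV x0); apply: infinitesimalMr.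
Qed.

Lemma val_unit_inf x : U x -> x != 0 -> ~ Inf x.
Proof. by move=> Ux x0 [_ r0]; move: (val_unit_neq0 Ux x0); rewrite r0 eqxx. Qed.

Lemma residue_unit x : O x -> res x != 0 -> U x.
Proof.
move=> Ox rx; case: (val_ring_cases x) => [[_ r0]|[//|[x0 Ix]]].
  by rewrite r0 eqxx in rx.
by case: (val_ring_infV Ix x0).
Qed.

Lemma val_ring_not_inf x : O x -> ~ U x -> Inf x.
Proof.
move=> Ox nU; case: (val_ring_cases x) => [//|[//|[x0 Ix]]].
by case: (val_ring_infV Ix x0).
Qed.

Lemma val_ring_root x k : (0 < k)%N -> O (x ^+ k) -> O x.
Proof.
move=> k0 Oxk; case: (val_ring_cases x) => [[]//|[[]//|[x0 Ix]]].
have := infinitesimalX k0 Ix; rewrite exprVn => /val_ring_infV [] //.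
by rewrite expf_neq0.
Qed.

Lemma infinitesimal_root x k : (0 < k)%N -> Inf (x ^+ k) -> Inf x.
Proof.
move=> k0 Ix; have [-> | x0] := eqVneq x 0; first exact: infinitesimal0.
have Ox : O x by apply: (val_ring_root k0); case: Ix.
apply: val_ring_not_inf => // -[_ Ox'].
have : U (x ^+ k) by split; [case: Ix|rewrite -exprVn; apply: val_ringX].
by move/val_unit_inf; apply => //; rewrite expf_neq0.
Qed.

Lemma val_unit_root x k : (0 < k)%N -> U (x ^+ k) -> U x.
Proof.
move=> k0 [Ox Ox']; split; apply: (val_ring_root k0) => //.
by rewrite exprVn.
Qed.

Lemma val_unitM x y : U x -> U y -> U (x * y).
Proof. by move=> [? ?] [? ?]; split; rewrite ?invfM; apply: val_ringM. Qed.

Lemma val_unitV x : U x -> U x^-1.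
Proof. by move=> [? ?]; split; rewrite ?invrK. Qed.

Lemma val_unitX x k : U x -> U (x ^+ k).
Proof. by move=> [? ?]; split; rewrite -?exprVn; apply: val_ringX. Qed.

Lemma val_unit1 : U 1.
Proof. by split; rewrite ?invr1; apply: val_ring1. Qed.

Lemma val_unitXz x (k : int) : U x -> U (x ^ k).
Proof.
move=> Ux; case: k => k; first exact: val_unitX.
by rewrite NegzE -exprnN; apply/val_unitV/val_unitX.
Qed.

Lemma val_ringMU x u : U u -> u != 0 -> O (x * u) -> O x.
Proof.
by move=> [_ Ou] u0 Ox; rewrite -(mulfK u0 x); apply: val_ringM.
Qed.

Lemma infinitesimalMU x u : U u -> u != 0 -> Inf (x * u) -> Inf x.
Proof.
by move=> [_ Ou] u0 Ox; rewrite -(mulfK u0 x); apply: infinitesimalMr.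
Qed.

(** The ultrametric inequality for the weight [e v(x) + v(w)]: the one of [x] and [y] with the
    smaller valuation is factored out, which leaves 1 plus an integral quotient. *)
Lemma val_ring_sumX x y w e : O (x ^+ e * w) -> O (y ^+ e * w) -> O ((x + y) ^+ e * w).
Proof.
have [-> | y0] := eqVneq y 0; first by rewrite addr0.
have [-> | x0] := eqVneq x 0; first by rewrite add0r.
move=> Ox Oy.
have [Oq|[Oq _]] := val_ring_total P (x / y).
  have -> : (x + y) ^+ e * w = (x / y + 1) ^+ e * (y ^+ e * w).
    by rewrite mulrA -exprMn mulrDl mul1r mulfVK.
  by apply: val_ringM => //; apply/val_ringX/val_ringD => //; apply: val_ring1.
have -> : (x + y) ^+ e * w = (1 + (x / y)^-1) ^+ e * (x ^+ e * w).
  by rewrite mulrA -exprMn mulrDl mul1r invf_div mulfVK.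
by apply: val_ringM => //; apply/val_ringX/val_ringD => //; apply: val_ring1.
Qed.

Lemma infinitesimal_sumX x y w e :
  Inf (x ^+ e * w) -> Inf (y ^+ e * w) -> Inf ((x + y) ^+ e * w).
Proof.
have [-> | y0] := eqVneq y 0; first by rewrite addr0.
have [-> | x0] := eqVneq x 0; first by rewrite add0r.
move=> Ox Oy.
have [Oq|[Oq _]] := val_ring_total P (x / y).
  have -> : (x + y) ^+ e * w = (x / y + 1) ^+ e * (y ^+ e * w).
    by rewrite mulrA -exprMn mulrDl mul1r mulfVK.
  by apply: infinitesimalMl => //; apply/val_ringX/val_ringD => //; apply: val_ring1.
have -> : (x + y) ^+ e * w = (1 + (x / y)^-1) ^+ e * (x ^+ e * w).
  by rewrite mulrA -exprMn mulrDl mul1r invf_div mulfVK.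
by apply: infinitesimalMl => //; apply/val_ringX/val_ringD => //; apply: val_ring1.
Qed.

End Place.

(* The residue map of a valuation on [K[t]], seen on the monomials [x t^k] with
   [k] in [int]: [gval x k] says that [x t^k] is integral and [gres x k] is
   then its residue. *)
Record gplace (C K : fieldType) (iota : {rmorphism C -> K}) := GPlace {
  gval : K -> int -> Prop;
  gres : K -> int -> C;
  gval0 : forall k, gval 0 k;
  gvalD : forall x y k, gval x k -> gval y k -> gval (x + y) k;
  gvalM : forall x y k l, gval x k -> gval y l -> gval (x * y) (k + l);
  gval_iota : forall c, gval (iota c) 0;
  gresD : forall x y k, gval x k -> gval y k -> gres (x + y) k = gres x k + gres y k;
  gresM : forall x y k l, gval x k -> gval y l ->
    gres (x * y) (k + l) = gres x k * gres y l;
  gres_iota : forall c, gres (iota c) 0 = c;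
  gval_total : forall x k, x != 0 ->
    gval x k \/ (gval x^-1 (- k) /\ gres x^-1 (- k) = 0) }.

Section GPlaces.
Variables (C K : fieldType) (iota : {rmorphism C -> K}) (P : place iota).
Variables (pi : K) (e : nat).
Hypotheses (pi0 : pi != 0) (e0 : (0 < e)%N).
Local Notation O := (val_ring P).
Local Notation res := (residue P).
Local Notation Inf := (infinitesimal P).
Local Notation U := (val_unit P).

(** When [t] is given the valuation [v(pi) / e], the element [x ^+ e * pi ^ k] has [e] times the
    valuation of [x t^k]. Reading weights off this element avoids an [e]-th root of [pi]. *)
Lemma weightM x y (k l : int) :
  (x * y) ^+ e * pi ^ (k + l) = (x ^+ e * pi ^ k) * (y ^+ e * pi ^ l).
Proof. by rewrite exprMn expfzDr // mulrACA. Qed.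

Lemma weightV x (k : int) : x^-1 ^+ e * pi ^ (- k) = (x ^+ e * pi ^ k)^-1.
Proof. by rewrite invfM -exprVn -invr_expz. Qed.


Section Edge.
(* Holds for the least [e] such that the slope [v pi / e] of [t] has an
   [e]-th multiple in the value group. *)
Hypothesis emin : forall x k, x != 0 -> U (x ^+ e * pi ^ k) -> (e%:Z %| k)%Z.

Definition edge_val x k := O (x ^+ e * pi ^ k).
(** If [e] does not divide [k], an integral [x t^k] has positive weight by [emin], so its residue is
    0; otherwise [pi ^ (k / e)] takes the place of [t^k]. *)
Definition edge_res x (k : int) :=
  if (e%:Z %| k)%Z then res (x * pi ^ (k %/ e)%Z) else 0.

Lemma weight_dvd x (k : int) : (e%:Z %| k)%Z ->
  (x * pi ^ (k %/ e)%Z) ^+ e = x ^+ e * pi ^ k.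
Proof. by move=> dk; rewrite exprMn [(_ ^ _) ^+ e]exprnP exprz_exp divzK. Qed.

Lemma edge_val_dvd x (k : int) : (e%:Z %| k)%Z -> edge_val x k ->
  O (x * pi ^ (k %/ e)%Z).
Proof.
by move=> dk; rewrite /edge_val -weight_dvd //; apply: val_ring_root.
Qed.

Lemma edge_res_eq0 x k : edge_val x k -> edge_res x k = 0 ->
  Inf (x ^+ e * pi ^ k).
Proof.
move=> Ox; rewrite /edge_res; have [-> _|x0] := eqVneq x 0.
  by rewrite expr0n eqn0Ngt e0 mul0r; apply: infinitesimal0.
case: ifP => [dk r0|dk _]; last first.
  by apply: val_ring_not_inf => // Uk; rewrite (emin x0 Uk) in dk.
rewrite -weight_dvd //; apply: infinitesimalX => //.
by split=> //; apply: edge_val_dvd.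
Qed.

Lemma edge_res_inf x k : Inf (x ^+ e * pi ^ k) -> edge_res x k = 0.
Proof.
rewrite /edge_res; case: ifP => // dk; rewrite -weight_dvd //.
by move/(infinitesimal_root e0) => -[].
Qed.

Lemma edge_valD x y k : edge_val x k -> edge_val y k -> edge_val (x + y) k.
Proof. exact: val_ring_sumX. Qed.

Lemma edge_valM x y k l : edge_val x k -> edge_val y l -> edge_val (x * y) (k + l).
Proof. by rewrite /edge_val weightM; apply: val_ringM. Qed.

Lemma edge_resD x y k : edge_val x k -> edge_val y k ->
  edge_res (x + y) k = edge_res x k + edge_res y k.
Proof.
rewrite /edge_res; case: ifP => [dk Ox Oy|]; last by rewrite addr0.
by rewrite mulrDl residueD //; apply: edge_val_dvd.
Qed.

Lemma edge_resM x y k l : edge_val x k -> edge_val y l ->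
  edge_res (x * y) (k + l) = edge_res x k * edge_res y l.
Proof.
move=> Ox Oy; have [rx0|rx0] := eqVneq (edge_res x k) 0.
  rewrite rx0 mul0r; apply: edge_res_inf; rewrite weightM.
  by apply: infinitesimalMr => //; apply: edge_res_eq0.
have [ry0|ry0] := eqVneq (edge_res y l) 0.
  rewrite ry0 mulr0; apply: edge_res_inf; rewrite weightM.
  by apply: infinitesimalMl => //; apply: edge_res_eq0.
move: rx0 ry0; rewrite /edge_res; case: ifP => [dk _|]; last by rewrite eqxx.
case: ifP => [dl _|]; last by rewrite eqxx.
rewrite rpredD // divzDl // expfzDr // mulrACA residueM //;
  exact: edge_val_dvd.
Qed.

Lemma edge_val_total x k : x != 0 ->
  edge_val x k \/ (edge_val x^-1 (- k) /\ edge_res x^-1 (- k) = 0).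
Proof.
move=> x0; have [Ox|[Ox rx]] := val_ring_total P (x ^+ e * pi ^ k); first by left.
right; rewrite /edge_val weightV; split=> //.
by apply: edge_res_inf; rewrite weightV.
Qed.

Lemma edge_val0 k : edge_val 0 k.
Proof. by rewrite /edge_val expr0n eqn0Ngt e0 mul0r; apply: val_ring0. Qed.

Lemma edge_val_iota c : edge_val (iota c) 0.
Proof. by rewrite /edge_val expr0z mulr1; apply/val_ringX/val_ring_iota. Qed.

Lemma edge_res_iota c : edge_res (iota c) 0 = c.
Proof. by rewrite /edge_res dvdz0 div0z expr0z mulr1 residue_iota. Qed.

Definition edge_place : gplace iota :=
  GPlace edge_val0 edge_valD edge_valM edge_val_iota edge_resD edge_resM
    edge_res_iota edge_val_total.

End Edge.

Section Vertex.
(* [s = 1] selects the lowest and [s = -1] the highest exponent among the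
   monomials of least weight. *)
Variable s : int.
Hypothesis s0 : s != 0.

(** The valuation ring of the lexicographic pair (weight, [s * k]). A monomial with [k != 0] that is
    integral for this pair has residue 0. *)
Definition vertex_val x (k : int) :=
  O (x ^+ e * pi ^ k) /\ (s * k < 0 -> Inf (x ^+ e * pi ^ k)).
Definition vertex_res x (k : int) := if k == 0 then res x else 0.

Lemma vertex_valD x y k : vertex_val x k -> vertex_val y k -> vertex_val (x + y) k.
Proof.
move=> [Ox Ix] [Oy Iy]; split; first exact: val_ring_sumX.
by move=> sk; apply: infinitesimal_sumX; [exact: Ix|exact: Iy].
Qed.

Lemma vertex_valM x y k l :
  vertex_val x k -> vertex_val y l -> vertex_val (x * y) (k + l).
Proof.
move=> [Ox Ix] [Oy Iy]; rewrite /vertex_val weightM.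
split=> [|skl]; first exact: val_ringM.
have [sk|sk] := ltP (s * k) 0; first by apply: infinitesimalMr => //; apply: Ix.
apply: infinitesimalMl => //; apply: Iy.
by apply: le_lt_trans skl; rewrite mulrDr lerDr.
Qed.

Lemma vertex_val_res x : vertex_val x 0 -> O x.
Proof. by rewrite /vertex_val expr0z mulr1 => -[/(val_ring_root e0)]. Qed.

Lemma vertex_resD x y k : vertex_val x k -> vertex_val y k ->
  vertex_res (x + y) k = vertex_res x k + vertex_res y k.
Proof.
rewrite /vertex_res; case: eqP => [-> Ox Oy|]; last by rewrite addr0.
by rewrite residueD //; apply: vertex_val_res.
Qed.

Lemma vertex_resM x y k l : vertex_val x k -> vertex_val y l ->
  vertex_res (x * y) (k + l) = vertex_res x k * vertex_res y l.
Proof.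
move=> Ox Oy; rewrite /vertex_res.
have [kl0|kl0] := eqVneq (k + l) 0; last first.
  case: eqVneq => [k0|]; last by rewrite mul0r.
  by case: eqVneq => [l0|]; [rewrite k0 l0 addr0 eqxx in kl0|rewrite mulr0].
have lE : l = - k by apply/eqP; rewrite -addr_eq0 addrC kl0.
have [k0|k0] := eqVneq k 0.
  move: Ox Oy; rewrite lE k0 oppr0 eqxx => Ox Oy.
  by rewrite residueM //; apply: vertex_val_res.
rewrite mul0r; suff [] : Inf (x * y) by [].
apply: (infinitesimal_root e0); rewrite -[_ ^+ e]mulr1 -(expr0z pi) -kl0 weightM.
case: Ox Oy => Ox Ix [Oy Iy].
have [sk|sk] := ltP (s * k) 0; first by apply: infinitesimalMr => //; apply: Ix.
apply: infinitesimalMl => //; apply: Iy.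
by rewrite lE mulrN oppr_lt0 lt_def sk mulf_neq0.
Qed.

Lemma vertex_val_total x k : x != 0 ->
  vertex_val x k \/ (vertex_val x^-1 (- k) /\ vertex_res x^-1 (- k) = 0).
Proof.
move=> x0; rewrite /vertex_val weightV.
have xk0 : x ^+ e * pi ^ k != 0 by rewrite mulf_neq0 ?expf_neq0 ?expfz_neq0.
have [Ix|[[Ox Ox']|[_ Ix]]] := val_ring_cases P (x ^+ e * pi ^ k).
- by left; split=> //; case: Ix.
- have [sk|sk] := ltP (s * k) 0; last by left.
  right; split; first by split=> //; rewrite mulrN oppr_lt0 ltNge (ltW sk).
  rewrite /vertex_res oppr_eq0; case: eqP => // k0.
  by rewrite k0 mulr0 in sk.
right; split; first by split=> //; case: Ix.
rewrite /vertex_res oppr_eq0; case: eqP => // k0.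
move: Ix; rewrite k0 expr0z mulr1 -exprVn.
by move/(infinitesimal_root e0) => -[].
Qed.

Lemma vertex_val0 k : vertex_val 0 k.
Proof.
rewrite /vertex_val expr0n eqn0Ngt e0 mul0r.
by split=> [|_]; [exact: val_ring0|exact: infinitesimal0].
Qed.

Lemma vertex_val_iota c : vertex_val (iota c) 0.
Proof.
by rewrite /vertex_val expr0z mulr1 mulr0; split=> //; apply/val_ringX/val_ring_iota.
Qed.

Lemma vertex_res_iota c : vertex_res (iota c) 0 = c.
Proof. by rewrite /vertex_res eqxx residue_iota. Qed.

Definition vertex_place : gplace iota :=
  GPlace vertex_val0 vertex_valD vertex_valM vertex_val_iota vertex_resD
    vertex_resM vertex_res_iota vertex_val_total.

End Vertex.

End GPlaces.

Section Slopes.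
Variables (C K : fieldType) (iota : {rmorphism C -> K}) (P : place iota).
Local Notation O := (val_ring P).
Local Notation Inf := (infinitesimal P).
Local Notation U := (val_unit P).

Lemma val_ring_root_eqv x y a b : (0 < a)%N -> (0 < b)%N -> y != 0 -> x != 0 ->
  U (x ^+ a / y ^+ b) -> (O x <-> O y) /\ (Inf x <-> Inf y).
Proof.
move=> a0 b0 y0 x0 Uxy; set u := x ^+ a / y ^+ b in Uxy.
have u0 : u != 0 by rewrite mulf_neq0 ?invr_eq0 ?expf_neq0.
have xE : x ^+ a = y ^+ b * u by rewrite /u mulrC divfK // expf_neq0.
have [Ou Ou'] := Uxy; split; split.
- move=> Ox; apply: (val_ring_root b0); apply: (val_ringMU Uxy u0).
  by rewrite -xE; apply: val_ringX.
- move=> Oy; apply: (val_ring_root a0); rewrite xE.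
  by apply: val_ringM => //; apply: val_ringX.
- move=> Ox; apply: (infinitesimal_root b0); apply: (infinitesimalMU Uxy u0).
  by rewrite -xE; apply: infinitesimalX.
- move=> Oy; apply: (infinitesimal_root a0); rewrite xE.
  by apply: infinitesimalMr => //; apply: infinitesimalX.
Qed.

(** The slope [v(pi0) / e0] is rewritten as [v(pi) / e], where [e] is the least positive integer
    such that [e] times the slope is a value. Minimality yields the divisibility that [edge_place]
    requires. *)
Lemma minimal_slope pi0 e0 : pi0 != 0 -> (0 < e0)%N ->
  exists pi e, [/\ pi != 0, (0 < e)%N,
    forall x k, x != 0 -> U (x ^+ e * pi ^ k) -> (e%:Z %| k)%Z &
    forall x k, x != 0 ->
      (O (x ^+ e * pi ^ k) <-> O (x ^+ e0 * pi0 ^ k)) /\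
      (Inf (x ^+ e * pi ^ k) <-> Inf (x ^+ e0 * pi0 ^ k))].
Proof.
move=> p0 e00.
pose Q e := (0 < e)%N /\ exists2 pi, pi != 0 & U (pi ^+ e0 / pi0 ^+ e).
have [e [Qe emin]] : exists e, Q e /\ forall k, Q k -> (e <= k)%N.
  have [] := @ex_minnP (fun k => `[< Q k >]).
    exists e0; apply/asboolP; split=> //; exists pi0 => //.
    by rewrite divff ?expf_neq0 //; apply: val_unit1.
  by move=> e /asboolP Qe emin; exists e; split=> // k /asboolP /emin.
case: Qe => epos [pi pin0 Upi]; exists pi, e; split=> // x k x0.
  move=> Uk; apply/dvdz_mod0P/eqP/negP => /negP r0.
  (* If [e v(x) + k v(pi) = 0] and [k = q e + r], then [r] times the slope is the valuation of
     [(x * pi ^ q)^-1]; a nonzero [r < e] contradicts the choice of [e]. *)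
  set r := (k %% e)%Z in r0; set q := (k %/ e)%Z.
  have eN0 : e%:Z != 0 by rewrite -lt0n.
  have [r1 rE] : exists r1 : nat, r = r1%:Z.
    by exists `|r|%N; rewrite gez0_abs // modz_ge0.
  have r1e : (r1 < e)%N by rewrite -ltz_nat -rE ltz_pmod // ltz_nat.
  have r1pos : (0 < r1)%N by rewrite lt0n -eqz_nat -rE.
  suff /emin : Q r1 by rewrite leqNgt r1e.
  split=> //; exists (x * pi ^ q)^-1; first by rewrite invr_eq0 mulf_neq0 ?expfz_neq0.
  apply: (val_unit_root epos).
  have -> : ((x * pi ^ q)^-1 ^+ e0 / pi0 ^+ r1) ^+ e =
      ((x ^+ e * pi ^ k) ^+ e0)^-1 * ((pi ^+ e0 / pi0 ^+ e) ^+ r1).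
    have -> : pi ^ k = (pi ^ q) ^+ e * pi ^+ r1.
      by rewrite {1}(divz_eq k e) expfzDr // -/q -/r rE [_ ^+ e]exprnP exprz_exp.
    rewrite !exprMn !exprVn !exprMn -!exprM [(e0 * r1)%N]mulnC [(r1 * e)%N]mulnC.
    rewrite ![(e * e0)%N]mulnC !invfM; set a := x ^+ _; set b := _ ^+ (e0 * e).
    by field; rewrite !expf_neq0 ?expfz_neq0.
  by apply: val_unitM; [apply/val_unitV/val_unitX|apply: val_unitX].
have W0 a p : p != 0 -> x ^+ a * p ^ k != 0.
  by move=> pp; rewrite mulf_neq0 ?expf_neq0 ?expfz_neq0.
apply: (val_ring_root_eqv e00 epos) => //; try exact: W0.
have -> : (x ^+ e * pi ^ k) ^+ e0 / (x ^+ e0 * pi0 ^ k) ^+ e =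
    (pi ^+ e0 / pi0 ^+ e) ^ k.
  rewrite !exprMn -!exprM [(e0 * e)%N]mulnC -mulf_div divff ?expf_neq0 // mul1r.
  rewrite expfzMl exprz_inv -invr_expz !exprnP !exprz_exp.
  by rewrite [k * e0%:Z]mulrC [k * e%:Z]mulrC.
exact: val_unitXz.
Qed.

End Slopes.

(** * Fractions, and polynomials determined by their values *)

Local Open Scope quotient_scope.
Lemma fraction_repr (A : idomainType) (x : {fraction A}) :
  exists h g : A, g != 0 /\ x = FracField.tofrac h / FracField.tofrac g.
Proof.
elim/quotW: x => x; exists x.1, x.2; have g0 := denom_ratioP x; split=> //.
have tg0 : FracField.tofrac x.2 != 0 by rewrite tofrac_eq0.
apply: (canRL (mulfK tg0)).
transitivity (FracField.mul (\pi_(FracField.type A) x) (FracField.tofrac x.2)) => //.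
unlock FracField.tofrac; rewrite -FracField.pi_mul; apply/eqmodP.
rewrite /= FracField.equivfE /FracField.mulf !numden_Ratio ?mulr1 ?oner_eq0 //=.
by rewrite mulrC.
Qed.
Local Close Scope quotient_scope.

Lemma rmorph_mmap n (R : nzRingType) (S T : comNzRingType) (phi : {rmorphism S -> T})
    (f : {rmorphism R -> S}) (h : 'I_n -> S) (p : {mpoly R[n]}) :
  phi (mmap f h p) = mmap (phi \o f) (phi \o h) p.
Proof.
rewrite /mmap rmorph_sum; apply: eq_bigr => m _.
rewrite rmorphM /mmap1 rmorph_prod; congr (_ * _).
by apply: eq_bigr => i _; rewrite rmorphXn.
Qed.

Lemma eq_mmap n (R S : nzRingType) (f f' : R -> S) (h h' : 'I_n -> S) (p : {mpoly R[n]}) :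
  f =1 f' -> h =1 h' -> mmap f h p = mmap f' h' p.
Proof.
move=> ff hh; rewrite /mmap; apply: eq_bigr => m _; rewrite ff; congr (_ * _).
by apply: eq_bigr => i _; rewrite hh.
Qed.

Lemma poly_nat_eq0 (D : idomainType) (p : {poly D}) (a : nat -> D) :
  injective a -> (forall k, p.[a k] = 0) -> p = 0.
Proof.
move=> ainj pa; apply: (@roots_geq_poly_eq0 _ _ (map a (iota 0 (size p)))).
- by apply/allP => x /mapP [k _ ->]; apply/rootP.
- by rewrite map_inj_uniq ?iota_uniq.
- by rewrite size_map size_iota.
Qed.

(** Natural sample points suffice; being fixed by conjugation, they are what [heval_eq0] can
    offer. *)
Lemma mpoly_nat_eq0 n (D : numDomainType) (p : {mpoly D[n]}) :
  (forall v : 'I_n -> nat, p.@[fun i => (v i)%:R] = 0) -> p = 0.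
Proof.
move=> pv; pose B := {mpoly D[n]}; pose c : {rmorphism D -> B} := @mpolyC n D.
have ainj : injective (fun k => c k%:R).
  by move=> j k /= /(can_inj (@mpolyCK n D)) /eqP; rewrite eqr_nat => /eqP.
(* the coordinates are replaced one at a time by indeterminates *)
have H k : (k <= n)%N -> forall v : 'I_n -> B,
    (forall i : 'I_n, (k <= i)%N -> exists j, v i = c j%:R) -> mmap c v p = 0.
  elim: k => [_ v vP|k IH kn v vP].
    have /fin_all_exists [u uE] : forall i, exists j, v i = c j%:R.
      by move=> i; apply: vP.
    have := congr1 c (pv u); rewrite rmorph0 => <-.
    rewrite /meval rmorph_mmap; apply: eq_mmap => // i; exact: uE.
  pose k' := Ordinal kn.
  pose q : {poly B} := mmap (polyC \o c) (fun i => if i == k' then 'X else (v i)%:P) p.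
  have qE (x : B) : q.[x] = mmap c (fun i => if i == k' then x else v i) p.
    rewrite -horner_evalE (rmorph_mmap (horner_eval x)).
    apply: eq_mmap => i /=; first by rewrite /horner_eval hornerC.
    by rewrite /horner_eval; case: ifP => _; rewrite ?hornerX ?hornerC.
  have q0 : q = 0.
    apply: (poly_nat_eq0 ainj) => j; rewrite qE; apply: IH => [|i ki]; first exact: ltnW.
    case: eqVneq => [_|ik]; first by exists j.
    by apply: vP; rewrite ltn_neqAle ki andbT eq_sym; apply: contra ik => /eqP ik; apply/eqP/val_inj.
  have := qE (v k'); rewrite q0 horner0 => ->.
  by apply: eq_mmap => // i; case: eqVneq => [->|].
rewrite -[LHS]comp_mpoly_id /comp_mpoly.
rewrite (@eq_mmap _ _ _ _ c _ (fun i => 'X_i)) => [|//|i]; last by rewrite tnth_mktuple.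
by apply: (H n) => // i; rewrite leqNgt ltn_ord.
Qed.

Lemma mpoly_eval_eq0 n (D : numDomainType) (p : {mpoly D[n]}) :
  (forall v, p.@[v] = 0) -> p = 0.
Proof. by move=> pv; apply: mpoly_nat_eq0. Qed.

Lemma coefM_top (S : nzSemiRingType) (a b : {poly S}) m k : (size a <= m.+1)%N -> (size b <= k.+1)%N ->
  (a * b)`_(m + k) = a`_m * b`_k.
Proof.
move=> sa sb; rewrite coefM.
have mk : (m < (m + k).+1)%N by rewrite ltnS leq_addr.
rewrite (bigD1 (Ordinal mk)) //= addKn big1 ?addr0 // => i.
rewrite -val_eqE /= neq_ltn => /orP [im|mi].
  by rewrite [b`__]nth_default ?mulr0 //; apply: leq_trans sb _; lia.
by rewrite [a`__]nth_default ?mul0r // (leq_trans sa).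
Qed.

(** * Sign of a Hermitian form of polynomial vectors along a ray *)

Section Sign.
Variable R : rcfType.
Local Notation Re := (@complex.Re R).
Local Notation Im := (@complex.Im R).

(** The squared modulus as an element of [R], since the norm on [R[i]] has values in [R[i]]. *)
Definition nsq (z : R[i]) : R := Re z ^+ 2 + Im z ^+ 2.

Lemma nsqE z : (nsq z)%:C%C = z^* * z.
Proof. by rewrite /nsq add_Re2_Im2 normCKC. Qed.

Lemma nsqM z w : nsq (z * w) = nsq z * nsq w.
Proof. by case: z w => a b [c d]; rewrite /nsq /=; ring. Qed.

Lemma nsq_gt0 z : z != 0 -> 0 < nsq z.
Proof.
move=> z0; rewrite -ltcR nsqE -normCKC; apply: exprn_gt0.
by rewrite normr_gt0.
Qed.

Lemma fresh_real (s : seq R) : exists y, y \notin s.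
Proof.
suff [y ys] : exists y, forall x, x \in s -> x < y.
  by exists y; apply/negP => /ys; rewrite ltxx.
elim: s => [|x s [y ys]]; first by exists 0.
exists (Num.max x y + 1) => z; rewrite inE => /orP [/eqP ->|/ys zy].
  by rewrite ltr_pwDr // le_max lexx.
by apply: lt_trans zy _; rewrite ltr_pwDr // le_max lexx orbT.
Qed.

Lemma size_mul_top (a : {poly R}) m : (size a <= m.+1)%N -> (size (a * a)%R <= (m + m).+1)%N.
Proof. by move=> sa; apply: leq_trans (size_polyMleq _ _) _; lia. Qed.

(** Opposite signs near 0 and near infinity would produce a positive root. *)
Lemma sign_poly_no_pos_root (S : {poly R}) k : (size S <= k.+1)%N ->
  (forall x, 0 < x -> S.[x] != 0) -> 0 < S`_k -> S`_0 != 0 -> 0 < S`_0.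
Proof.
move=> sS nr Sk S0; rewrite lt_def S0 leNgt; apply/negP => {}S0.
have lS : lead_coef S = S`_k.
  rewrite lead_coefE; congr (S`__); apply/eqP; rewrite eqn_leq.
  have kS : (k < size S)%N.
    by rewrite ltnNge; apply/negP => /leq_sizeP /(_ k (leqnn k)) S0'; rewrite S0' ltxx in Sk.
  by rewrite -ltnS prednK ?(leq_ltn_trans _ kS) // sS -ltnS prednK // (leq_ltn_trans _ kS).
have [n Sn] : exists n, forall x, x >= n -> S.[x] >= lead_coef S.
  by apply: poly_pinfty_gt_lc; rewrite lS.
pose x := Num.max n 1.
have x0 : 0 < x by rewrite lt_max ltr01 orbT.
have Sx : 0 < S.[x] by apply: lt_le_trans (Sn x _); rewrite ?lS // le_max lexx.
have [y] : {y | y \in `]0, x[ & root S y}.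
  by apply: poly_ivtoo; rewrite ?(ltW x0) // horner_coef0 nmulr_rlt0.
by rewrite inE /= => /andP [y0 _] /rootP Sy; move: (nr y y0); rewrite Sy eqxx.
Qed.

(** The finitely many zeros have finitely many slopes [Im z / Re z]; a ray of another slope in the
    half-plane [Re > 0] misses them. *)
Lemma generic_ray (Q : {poly R[i]}) : Q != 0 ->
  exists2 w : R[i], w != 0 & forall s : R, 0 < s -> Q.[s%:C%C * w] != 0.
Proof.
move=> Q0; have [rs QE] := closed_field_poly_normal Q.
have [y yrs] := fresh_real [seq Im z / Re z | z <- rs].
exists (Complex 1 y); first by rewrite eq_complex /= oner_eq0.
move=> s s0; apply/negP => Qs.
have : root (\prod_(z <- rs) ('X - z%:P)) (s%:C%C * Complex 1 y).
  by move: Qs; rewrite QE hornerZ mulf_eq0 lead_coef_eq0 (negbTE Q0).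
rewrite root_prod_XsubC => zrs; move/negP: yrs; apply; apply/mapP.
exists (s%:C%C * Complex 1 y) => //=.
by rewrite !mul0r mulr1 subr0 addr0 mulrAC divff ?mul1r // gt_eqF.
Qed.

Lemma horner_complex (P : {poly R[i]}) n (s : R) : (size P <= n)%N ->
  P.[s%:C%C] = Complex (\poly_(j < n) Re P`_j).[s] (\poly_(j < n) Im P`_j).[s].
Proof.
move=> sP; rewrite (horner_coef_wide _ sP) !horner_poly [RHS]complexE /= !rmorph_sum /=.
rewrite mulr_sumr -big_split /=; apply: eq_bigr => i _.
by rewrite {1}[P`_i]complexE mulrDl !rmorphM /= !rmorphXn /= mulrA.
Qed.

Lemma horner_ReIm (P : {poly R[i]}) n (s : R) : (size P <= n)%N ->
  nsq P.[s%:C%C] = (\poly_(j < n) Re P`_j).[s] ^+ 2 + (\poly_(j < n) Im P`_j).[s] ^+ 2.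
Proof. by move=> sP; rewrite (horner_complex _ sP). Qed.

(* On a ray avoiding the zeros of [Q] the form [sum_i d_i |P_i|^2] has constant
   sign, so its lowest and highest coefficients agree in sign. *)
Lemma sign_lowest_highest I (d : 'I_I -> R) (P : 'I_I -> {poly R[i]}) (Q : {poly R[i]}) l k :
  Q != 0 -> (forall y, Q.[y] != 0 -> \sum_i d i * nsq (P i).[y] != 0) ->
  (l <= k)%N -> (forall i j, (j < l)%N -> (P i)`_j = 0) ->
  (forall i j, (k < j)%N -> (P i)`_j = 0) ->
  0 < \sum_i d i * nsq (P i)`_k -> \sum_i d i * nsq (P i)`_l != 0 ->
  0 < \sum_i d i * nsq (P i)`_l.
Proof.
move=> Q0 nz lk Pl Pk pk pl.
have [w w0 Qw] := generic_ray Q0.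
pose N := (k - l)%N.
(* On the ray, [P i] is [(s * w) ^+ l] times [P' i]. The form of the [P' i] is a real polynomial [S]
   in [s] whose extreme coefficients are, up to a positive factor, the forms at [l] and at [k]. *)
pose P' i : {poly R[i]} := \poly_(j < N.+1) ((P i)`_(l + j) * w ^+ j).
have sP' i : (size (P' i) <= N.+1)%N by apply: size_poly.
have PE i (s : R) : (P i).[s%:C%C * w] = (s%:C%C * w) ^+ l * (P' i).[s%:C%C].
  have sP : (size (P i) <= l + N.+1)%N.
    by apply/leq_sizeP => j jk; apply: Pk; rewrite addnS subnKC // in jk.
  rewrite (horner_coef_wide _ sP) big_split_ord /= big1 ?add0r; last first.
    by move=> j _; rewrite Pl ?mul0r.
  rewrite horner_poly mulr_sumr; apply: eq_bigr => j _.
  by rewrite exprD [(_ * w) ^+ j]exprMn; ring.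
pose a i := \poly_(j < N.+1) Re (P' i)`_j; pose b i := \poly_(j < N.+1) Im (P' i)`_j.
pose S := \sum_i d i *: (a i * a i + b i * b i).
have SE s : S.[s] = \sum_i d i * nsq (P' i).[s%:C%C].
  rewrite horner_sum; apply: eq_bigr => i _.
  by rewrite hornerZ hornerD !hornerM (horner_ReIm _ (sP' i)) -!expr2.
have sa i : (size (a i) <= N.+1)%N by apply: size_poly.
have sb i : (size (b i) <= N.+1)%N by apply: size_poly.
have sS : (size S <= (N + N).+1)%N.
  apply: (leq_trans (size_sum _ _ _)); apply/bigmax_leqP => i _.
  apply: leq_trans (size_scale_leq _ _) _; apply: leq_trans (size_polyD _ _) _.
  by rewrite geq_max !size_mul_top.
have S0 : S`_0 = \sum_i d i * nsq (P i)`_l.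
  rewrite -horner_coef0 SE; apply: eq_bigr => i _; congr (_ * nsq _).
  by rewrite horner_coef0 coef_poly /= addn0 expr0 mulr1.
have SN : S`_(N + N) = (\sum_i d i * nsq (P i)`_k) * nsq (w ^+ N).
  rewrite coef_sum mulr_suml; apply: eq_bigr => i _.
  rewrite coefZ coefD !coefM_top // !coef_poly ltnSn -!expr2 -mulrA; congr (_ * _).
  by rewrite -nsqM /nsq subnKC.
rewrite -S0; apply: (sign_poly_no_pos_root sS).
- move=> x x0; apply/negP => /eqP Sx; move/negP: (nz _ (Qw x x0)); apply.
  rewrite (eq_bigr (fun i => nsq ((x%:C%C * w) ^+ l) * (d i * nsq (P' i).[x%:C%C]))).
    by rewrite -mulr_sumr -SE Sx mulr0.
  by move=> i _; rewrite PE nsqM mulrCA.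
- by rewrite SN mulr_gt0 // nsq_gt0 // expf_neq0.
by rewrite S0.
Qed.

End Sign.

(** * Non-vanishing of the form at a place *)

Section ScaledResidue.
Variables (C K : fieldType) (iota : {rmorphism C -> K}) (G : gplace iota).

(** All terms of [p / (c t^m)] are integral. In [rpoly] the exponents are shifted back by [m], so
    that the residue remains a polynomial. *)
Definition scaled c m (p : {poly K}) := forall k : nat, gval G (p`_k / c) (k%:Z - m%:Z).
Definition rpoly c m (p : {poly K}) : {poly C} :=
  \poly_(k < size p) gres G (p`_k / c) (k%:Z - m%:Z).

Lemma gres0 k : gres G 0 k = 0.
Proof. by apply: (addrI (gres G 0 k)); rewrite -gresD ?addr0 //; apply: gval0. Qed.

Lemma gval_sum I (r : seq I) (F : I -> K) k :
  (forall i, gval G (F i) k) -> gval G (\sum_(i <- r) F i) k.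
Proof.
move=> GF; elim: r => [|i r IH]; first by rewrite big_nil; apply: gval0.
by rewrite big_cons; apply: gvalD.
Qed.

Lemma gres_sum I (r : seq I) (F : I -> K) k : (forall i, gval G (F i) k) ->
  gres G (\sum_(i <- r) F i) k = \sum_(i <- r) gres G (F i) k.
Proof.
move=> GF; elim: r => [|i r IH]; first by rewrite !big_nil gres0.
by rewrite !big_cons gresD ?IH //; apply: gval_sum.
Qed.

Lemma coef_rpoly c m p k : (rpoly c m p)`_k = gres G (p`_k / c) (k%:Z - m%:Z).
Proof.
rewrite coef_poly; case: ltnP => // sk.
by rewrite nth_default // mul0r gres0.
Qed.

Lemma scaled0 c m : scaled c m 0.
Proof. by move=> k; rewrite coef0 mul0r; apply: gval0. Qed.

Lemma scaledD c m p q : scaled c m p -> scaled c m q -> scaled c m (p + q).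
Proof. by move=> sp sq k; rewrite coefD mulrDl; apply: gvalD. Qed.

Lemma scaledZ c m a p : scaled c m p -> scaled c m ((iota a)%:P * p).
Proof.
move=> sp k; rewrite coefCM -mulrA -[_ - _]add0r.
by apply: gvalM; [apply: gval_iota|apply: sp].
Qed.

Lemma rpolyD c m p q : scaled c m p -> scaled c m q ->
  rpoly c m (p + q) = rpoly c m p + rpoly c m q.
Proof.
by move=> sp sq; apply/polyP => k; rewrite coefD !coef_rpoly coefD mulrDl gresD.
Qed.

Lemma rpolyZ c m a p : scaled c m p ->
  rpoly c m ((iota a)%:P * p) = a *: rpoly c m p.
Proof.
move=> sp; apply/polyP => k; rewrite coefZ !coef_rpoly coefCM -mulrA.
by rewrite -{1}[_ - _]add0r gresM ?gres_iota //; apply: gval_iota.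
Qed.

Lemma scaled_termM c m c' m' p q k (i : 'I_k.+1) :
  scaled c m p -> scaled c' m' q ->
  gval G (p`_i * q`_(k - i) / (c * c')) (k%:Z - (m + m')%:Z) /\
  gres G (p`_i * q`_(k - i) / (c * c')) (k%:Z - (m + m')%:Z) =
  (rpoly c m p)`_i * (rpoly c' m' q)`_(k - i).
Proof.
move=> sp sq; rewrite !coef_rpoly -mulf_div.
have -> : k%:Z - (m + m')%:Z = (i%:Z - m%:Z) + ((k - i)%N%:Z - m'%:Z).
  by have := ltn_ord i; lia.
by split; [apply: gvalM|apply: gresM].
Qed.

Lemma scaledM c m c' m' p q : scaled c m p -> scaled c' m' q ->
  scaled (c * c') (m + m') (p * q).
Proof.
move=> sp sq k; rewrite coefM mulr_suml; apply: gval_sum => i.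
by case: (scaled_termM i sp sq).
Qed.

Lemma rpolyM c m c' m' p q : scaled c m p -> scaled c' m' q ->
  rpoly (c * c') (m + m') (p * q) = rpoly c m p * rpoly c' m' q.
Proof.
move=> sp sq; apply/polyP => k; rewrite coef_rpoly !coefM mulr_suml.
rewrite gres_sum => [|i]; last by case: (scaled_termM i sp sq).
by apply: eq_bigr => i _; case: (scaled_termM i sp sq).
Qed.

Lemma scaled_rescale c m c' m' p : c != 0 -> gval G (c / c') (m%:Z - m'%:Z) ->
  scaled c m p -> scaled c' m' p /\
  rpoly c' m' p = gres G (c / c') (m%:Z - m'%:Z) *: rpoly c m p.
Proof.
move=> c0 gc sp.
have E k : p`_k / c' = (c / c') * (p`_k / c) by rewrite [RHS]mulrC mulrA divfK.
have Ek (k : nat) : k%:Z - m'%:Z = (m%:Z - m'%:Z) + (k%:Z - m%:Z) by lia.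
split=> [k|]; first by rewrite E Ek; apply: gvalM.
by apply/polyP => k; rewrite coefZ !coef_rpoly E Ek gresM.
Qed.

End ScaledResidue.

Lemma seq_min_total (T : eqType) (le : T -> T -> Prop) (s : seq T) : s != [::] ->
  (forall x y, x \in s -> y \in s -> le x y \/ le y x) ->
  (forall x y z, x \in s -> y \in s -> z \in s -> le x y -> le y z -> le x z) ->
  exists2 x, x \in s & forall y, y \in s -> le x y.
Proof.
elim: s => // a [|b s] IH _ tot trans.
  exists a; first exact: mem_head.
  by move=> y; rewrite inE => /eqP ->; case: (tot a a (mem_head _ _) (mem_head _ _)).
have [x xs xmin] : exists2 x, x \in b :: s & forall y, y \in b :: s -> le x y.
  apply: IH => // [x y xs ys|x y z xs ys zs].
    by apply: tot; rewrite inE ?xs ?ys orbT.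
  by apply: trans; rewrite inE ?xs ?ys ?zs orbT.
have xas : x \in a :: b :: s by rewrite inE xs orbT.
have [ax|xa] := tot a x (mem_head _ _) xas.
  exists a => [|y]; first exact: mem_head.
  rewrite inE => /orP [/eqP ->|ys].
    by case: (tot a a (mem_head _ _) (mem_head _ _)).
  by apply: (trans a x y _ _ _ ax (xmin y ys)); rewrite ?mem_head // inE ys orbT.
exists x => // y; rewrite inE => /orP [/eqP -> //|ys].
exact: xmin.
Qed.

Section Pivot.
Variables (C K : fieldType) (iota : {rmorphism C -> K}) (G : gplace iota).

Lemma gres1 : gres G 1 0 = 1.
Proof. by rewrite -(rmorph1 iota) gres_iota. Qed.

(** The normaliser is a term of least weight among all terms of all the [p i]; divided by itself it
    has residue 1. *)
Lemma scaled_pivot I (p : 'I_I -> {poly K}) i0 : p i0 != 0 ->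
  exists c m i, [/\ c != 0, forall j, scaled G c m (p j) & rpoly G c m (p i) != 0].
Proof.
move=> pi0; pose N := \max_(i < I) size (p i).
pose s := [seq u <- [seq (i, k) | i <- enum 'I_I, k <- seq.iota 0 N] | (p u.1)`_u.2 != 0].
pose le (u v : 'I_I * nat) := gval G ((p v.1)`_v.2 / (p u.1)`_u.2) (v.2%:Z - u.2%:Z).
have sP u : u \in s = ((p u.1)`_u.2 != 0).
  rewrite mem_filter; case: eqVneq => //= pu.
  apply/allpairsP; exists u; rewrite mem_enum mem_iota /= add0n -surjective_pairing; split=> //.
  have us : (u.2 < size (p u.1))%N by rewrite ltnNge; apply: contra pu => /leq_sizeP ->.
  by apply: leq_trans us _; apply: leq_bigmax.
have [u us umin] : exists2 u, u \in s & forall v, v \in s -> le u v.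
  apply: seq_min_total.
  - apply/eqP => s0; have : (i0, (size (p i0)).-1) \in s by rewrite sP /= -lead_coefE lead_coef_eq0.
    by rewrite s0.
  - move=> u v; rewrite !sP => pu pv; rewrite /le.
    have := gval_total G (v.2%:Z - u.2%:Z) (mulf_neq0 pv (invr_neq0 pu)).
    by rewrite invf_div opprB => -[]; [left|case; right].
  - move=> u v w; rewrite !sP /le => pu pv pw uv vw.
    have -> : (p w.1)`_w.2 / (p u.1)`_u.2 =
      ((p w.1)`_w.2 / (p v.1)`_v.2) * ((p v.1)`_v.2 / (p u.1)`_u.2) by rewrite mulrA divfK.
    have -> : w.2%:Z - u.2%:Z = (w.2%:Z - v.2%:Z) + (v.2%:Z - u.2%:Z) by lia.
    exact: gvalM.
move: us; rewrite sP => pu; exists (p u.1)`_u.2, u.2, u.1; split=> //.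
  move=> j k; have [->|pjk] := eqVneq ((p j)`_k) 0; first by rewrite mul0r; apply: gval0.
  by apply: (umin (j, k)); rewrite sP.
apply/eqP => /polyP /(_ u.2); rewrite coef_rpoly divff // subrr gres1 coef0.
by apply/eqP; rewrite oner_eq0.
Qed.

End Pivot.

Section NonVanishing.
Variables (R : rcfType) (K : fieldType) (iota : {rmorphism R[i] -> K}) (G : gplace iota).
Variables (n : nat) (Theta : {rmorphism {mpoly R[i][n]} -> {poly K}}).
Hypothesis ThetaZ : forall a f, Theta (a *: f) = (iota a)%:P * Theta f.
Hypothesis Theta_inj : injective Theta.

Section Functional.
Variables (c : K) (m : nat) (y : R[i]).

Definition tscaled f := scaled G c m (Theta f).
Definition tres f : R[i] := (rpoly G c m (Theta f)).[y].

Lemma tscaled_sum I (a : 'I_I -> R[i]) f : (forall i, tscaled (f i)) ->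
  tscaled (\sum_i a i *: f i).
Proof.
rewrite /tscaled => sf; rewrite rmorph_sum; elim/big_ind: _ => [|? ?|i _].
- exact: scaled0.
- exact: scaledD.
by rewrite /= ThetaZ; apply: scaledZ.
Qed.

Lemma tres_sum I (a : 'I_I -> R[i]) f : (forall i, tscaled (f i)) ->
  tres (\sum_i a i *: f i) = \sum_i a i * tres (f i).
Proof.
move=> sf; rewrite /tres rmorph_sum.
suff [_ ->] : scaled G c m (\sum_i Theta (a i *: f i)) /\
  rpoly G c m (\sum_i Theta (a i *: f i)) = \sum_i a i *: rpoly G c m (Theta (f i)).
  by rewrite horner_sum; apply: eq_bigr => i _; rewrite hornerZ.
elim: (index_enum _) => [|i r [IH1 IH2]].
  rewrite !big_nil; split; first exact: scaled0.
  by apply/polyP => k; rewrite coef_rpoly !coef0 mul0r; exact: gres0.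
have si : scaled G c m (Theta (f i)) by exact: sf.
rewrite !big_cons ThetaZ; split; first by apply: scaledD => //; apply: scaledZ.
by rewrite rpolyD ?rpolyZ ?IH2 //; apply: scaledZ.
Qed.

End Functional.

Lemma tresM c m c' m' y f g : tscaled c m f -> tscaled c' m' g ->
  tres (c * c') (m + m') y (f * g) = tres c m y f * tres c' m' y g.
Proof. by move=> sf sg; rewrite /tres rmorphM rpolyM // hornerM. Qed.

(* [sum_k F_k (x) conj F_k = (sum_i d_i h_i (x) conj h_i) (sum_j d'_j h'_j (x) conj h'_j)]
   with the second tensor factor evaluated at the arbitrary point [x]. *)
Variables (I J L : nat) (d : 'I_I -> R) (h : 'I_I -> {mpoly R[i][n]}).
Variables (d' : 'I_J -> R) (h' : 'I_J -> {mpoly R[i][n]}).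
Variable F : 'I_L -> {mpoly R[i][n]}.
Hypothesis polar : forall x,
  (\sum_i ((d i)%:C%C * ((h i).@[x])^*) *: h i) *
  (\sum_j ((d' j)%:C%C * ((h' j).@[x])^*) *: h' j) = \sum_k ((F k).@[x])^* *: F k.
Hypothesis d0 : forall i, d i != 0.
Hypothesis d'0 : forall i, d' i != 0.
Hypothesis hfree : forall a, \sum_i a i *: h i = 0 -> forall i, a i = 0.
Hypothesis h'free : forall a, \sum_i a i *: h' i = 0 -> forall i, a i = 0.
Hypotheses (j0 : 'I_J) (h'j0 : h' j0 != 0) (k0 : 'I_L) (Fk0 : F k0 != 0).

Lemma conj_real (a : R) : (a%:C%C)^* = a%:C%C :> R[i].
Proof. by apply/CrealP; rewrite complex_real. Qed.

Lemma eq_mpoly_eval (f g : {mpoly R[i][n]}) : (forall x, f.@[x] = g.@[x]) -> f = g.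
Proof.
by move=> fg; apply/eqP; rewrite -subr_eq0; apply/eqP/mpoly_eval_eq0 => x; rewrite mevalB fg subrr.
Qed.

Lemma sum_conj_eq0 N (w : 'I_N -> R[i]) : \sum_k (w k)^* * w k = 0 -> forall k, w k = 0.
Proof.
move=> w0 k; apply/eqP; rewrite -normr_eq0 -sqrf_eq0; apply/eqP.
have wE i : (w i)^* * w i = `|w i| ^+ 2 by rewrite normCKC.
move: k isT; apply: psumr_eq0P => [i _|]; first exact: exprn_ge0.
by rewrite -[RHS]w0; apply: eq_bigr => i _; rewrite wE.
Qed.

(** Let [u], [v], [w] be the residue vectors of [h], [h'], [F]. A first residue of [polar] gives,
    after conjugation in [x], [A * B = \sum_k (w k)^* *: F k]; a second one gives [(sum d_i |u_i|^2)
    (sum d'_j |v_j|^2) = sum |w_k|^2]. If the first factor is 0, then [w = 0] and [A * B = 0],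
    against the independence of the [h i] and of the [h' j]. *)
Lemma nonvanishing c m i0 : c != 0 -> (forall i, tscaled c m (h i)) ->
    rpoly G c m (Theta (h i0)) != 0 ->
  exists2 Q : {poly R[i]}, Q != 0 & forall y, Q.[y] != 0 ->
    \sum_i (d i)%:C%C * ((tres c m y (h i))^* * tres c m y (h i)) != 0.
Proof.
move=> c0 sh hi0.
have Theta0 f : f != 0 -> Theta f != 0.
  by rewrite -(rmorph0 Theta) (inj_eq Theta_inj).
have [c' [m' [j1 [c'0 sh' hj1]]]] := scaled_pivot G (p := fun j => Theta (h' j)) (Theta0 _ h'j0).
have [cF [mF [k1 [cF0 sF Fk1]]]] := scaled_pivot G (p := fun j => Theta (F j)) (Theta0 _ Fk0).
(* Where this product does not vanish, each of the three residue vectors has a nonzero entry. *)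
exists (rpoly G c m (Theta (h i0)) * (rpoly G c' m' (Theta (h' j1)) * rpoly G cF mF (Theta (F k1)))).
  by rewrite !mulf_neq0.
move=> y; rewrite !hornerM !mulf_eq0 !negb_or => /and3P [ui0 vj1 wk1].
set u := fun i => tres c m y (h i); set v := fun j => tres c' m' y (h' j).
have sL x : tscaled (c * c') (m + m') (\sum_k ((F k).@[x])^* *: F k).
  rewrite -polar /tscaled rmorphM; apply: scaledM.
    exact: tscaled_sum.
  exact: tscaled_sum.
have tL x : tres (c * c') (m + m') y (\sum_k ((F k).@[x])^* *: F k) =
    (\sum_i ((d i)%:C%C * ((h i).@[x])^*) * u i) * (\sum_j ((d' j)%:C%C * ((h' j).@[x])^*) * v j).
  rewrite -polar tresM; try exact: tscaled_sum.
  by rewrite !tres_sum.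
have cc0 : c * c' != 0 by rewrite mulf_neq0.
(* [F] is integral for the normaliser [c * c']. Otherwise its residue [w] for its own pivot
   satisfies [sum_k conj(F_k(x)) w_k = 0] for all [x], so [sum_k conj(w_k) F_k = 0], and one more
   residue gives [sum_k |w_k|^2 = 0]. *)
have [gF|[gF rF]] := gval_total G (mF%:Z - (m + m')%:Z) (mulf_neq0 cF0 (invr_neq0 cc0)); last first.
  rewrite invf_div opprB in gF rF.
  exfalso; pose w k := tres cF mF y (F k).
  have wx x : \sum_k ((F k).@[x])^* * w k = 0.
    rewrite -tres_sum // /tres.
    by have [_ ->] := scaled_rescale cc0 gF (sL x); rewrite rF scale0r horner0.
  have Fw : \sum_k (w k)^* *: F k = 0.
    apply: eq_mpoly_eval => x; rewrite meval0 raddf_sum /=.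
    transitivity ((\sum_k ((F k).@[x])^* * w k)^*); last by rewrite wx rmorph0.
    rewrite rmorph_sum; apply: eq_bigr => k _.
    by rewrite /= mevalZ rmorphM /= conjCK mulrC.
  have w0 : \sum_k (w k)^* * w k = 0.
    rewrite -tres_sum // Fw /tres rmorph0.
    suff -> : rpoly G cF mF 0 = 0 by rewrite horner0.
    by apply/polyP => k; rewrite coef_rpoly !coef0 mul0r; exact: gres0.
  by move: wk1; rewrite -/(tres _ _ _ _) -/(w k1) (sum_conj_eq0 w0) eqxx.
have sF' k : tscaled (c * c') (m + m') (F k).
  by case: (scaled_rescale cF0 gF (sF k)).
pose w k := tres (c * c') (m + m') y (F k).
pose A := \sum_i ((d i)%:C%C * (u i)^*) *: h i.
pose B := \sum_j ((d' j)%:C%C * (v j)^*) *: h' j.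
have AB : A * B = \sum_k (w k)^* *: F k.
  apply: eq_mpoly_eval => x; rewrite mevalM !raddf_sum /=.
  transitivity ((tres (c * c') (m + m') y (\sum_k ((F k).@[x])^* *: F k))^*).
    rewrite tL rmorphM !rmorph_sum; congr (_ * _); apply: eq_bigr => i _ /=;
    by rewrite mevalZ !rmorphM /= conjCK conj_real mulrAC.
  rewrite tres_sum // rmorph_sum; apply: eq_bigr => k _ /=.
  by rewrite mevalZ rmorphM /= conjCK mulrC.
have A0 : A != 0.
  apply/eqP => /hfree /(_ i0) /eqP; rewrite mulf_eq0 conjC_eq0 -/(tres _ _ _ _) in ui0 *.
  by rewrite (negbTE ui0) orbF -(rmorph0 (real_complex R)) (inj_eq (@complexI R)) (negbTE (d0 _)).
have B0 : B != 0.
  apply/eqP => /h'free /(_ j1) /eqP; rewrite mulf_eq0 conjC_eq0 -/(tres _ _ _ _) in vj1 *.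
  by rewrite (negbTE vj1) orbF -(rmorph0 (real_complex R)) (inj_eq (@complexI R)) (negbTE (d'0 _)).
have E : tres (c * c') (m + m') y (A * B) = \sum_k (w k)^* * w k.
  by rewrite AB tres_sum.
rewrite tresM ?tres_sum // in E; try exact: tscaled_sum.
apply/eqP => rho0.
move: E; have -> : \sum_i ((d i)%:C%C * (u i)^*) * tres c m y (h i) = 0.
  by under eq_bigr do rewrite -mulrA; exact: rho0.
rewrite mul0r => /esym /sum_conj_eq0 w0.
move: (mulf_neq0 A0 B0); rewrite AB big1 ?eqxx // => k _.
by rewrite w0 rmorph0 scale0r.
Qed.

End NonVanishing.

(** * Walking along the Newton polygon *)

Section Walk.
Variables (R : rcfType) (K : fieldType) (iota : {rmorphism R[i] -> K}) (P : place iota).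
Variables (I : nat) (p : 'I_I -> {poly K}) (d : 'I_I -> R).
Local Notation O := (val_ring P).
Local Notation res := (residue P).
Local Notation Inf := (infinitesimal P).
Local Notation U := (val_unit P).

Hypothesis nonvanishing : forall (G : gplace iota) c m i0, c != 0 ->
  (forall i, scaled G c m (p i)) -> rpoly G c m (p i0) != 0 ->
  exists2 Q : {poly R[i]}, Q != 0 &
    forall y, Q.[y] != 0 -> \sum_i d i * nsq (rpoly G c m (p i)).[y] != 0.

(* [c] normalises the vector of [k]-th coefficients, [sg k c] is the value of
   the Hermitian form at its residue. *)
Definition normal k c :=
  [/\ c != 0, forall i, O ((p i)`_k / c) & exists i, res ((p i)`_k / c) != 0].
Definition sg k c := \sum_i d i * nsq (res ((p i)`_k / c)).

Lemma normal_unit k c c' : normal k c -> normal k c' -> U (c / c').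
Proof.
suff H a b : normal k a -> normal k b -> O (a / b).
  by move=> nc nc'; split; rewrite ?invf_div; apply: H.
move=> [a0 Oa [i ri]] [b0 Ob _]; have [_ Ui] := residue_unit (Oa i) ri.
have pi0 : (p i)`_k != 0 by apply: contra ri => /eqP ->; rewrite mul0r residue0.
have -> : a / b = ((p i)`_k / b) * ((p i)`_k / a)^-1.
  by rewrite invf_div mulrCA mulrA mulrAC -!mulrA mulKf // mulrC.
exact: val_ringM.
Qed.

(** Two normalisers differ by a unit, whose residue enters the form through its squared modulus;
    only the sign of [sg k c] carries information. *)
Lemma sg_rescale k c c' : normal k c -> normal k c' ->
  exists2 t, 0 < t & sg k c' = sg k c * t.
Proof.
move=> nc nc'; have Ucc := normal_unit nc nc'.
case: (nc) (nc') => [c0 Oc _] [c'0 _ _].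
exists (nsq (res (c / c'))).
  by rewrite nsq_gt0 //; apply: val_unit_neq0 => //; rewrite mulf_neq0 ?invr_eq0.
rewrite /sg mulr_suml; apply: eq_bigr => i _; rewrite -mulrA -nsqM; congr (_ * nsq _).
rewrite -residueM //; last by case: Ucc.
by rewrite mulrA divfK.
Qed.

Section Edge.
Variables (pi : K) (e : nat) (c : K) (k : nat).
Hypotheses (pi0 : pi != 0) (e0 : (0 < e)%N) (c0 : c != 0).
Hypothesis emin : forall x k, x != 0 -> U (x ^+ e * pi ^ k) -> (e%:Z %| k)%Z.
Let E := edge_place pi0 e0 emin.
Hypothesis scE : forall i, scaled E c k (p i).
Local Notation rp := (fun i => rpoly E c k (p i)).

(** At the end [l] of the edge, the vertex place has multiples of ['X^l] as residues of the [p i],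
    so non-vanishing at that place means [sg l c' != 0]. The edge form at [l] differs from [sg l c']
    by the squared modulus of the residue of [c' / c]. *)
Lemma edge_vertex s l i1 : s != 0 -> (rp i1)`_l != 0 ->
    (forall i j, s * (j%:Z - l%:Z) < 0 -> (rp i)`_j = 0) ->
  exists c', [/\ normal l c', sg l c' != 0,
    exists2 t, 0 < t & \sum_i d i * nsq (rp i)`_l = sg l c' * t &
    forall i j, vertex_val P pi e s ((p i)`_j / c') (j%:Z - l%:Z)].
Proof.
move=> s0 ri1 rlow; pose c' := (p i1)`_l; exists c'.
have c'0 : c' != 0.
  by apply: contra ri1 => /eqP c'0; rewrite coef_rpoly -/c' c'0 mul0r gres0.
have Vc : edge_val P pi e (c' / c) (l%:Z - k%:Z) by exact: scE.
have rc : edge_res P pi e (c' / c) (l%:Z - k%:Z) != 0 by rewrite coef_rpoly in ri1.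
have cc0 : c' / c != 0 by rewrite mulf_neq0 ?invr_eq0.
have Uc : U ((c' / c) ^+ e * pi ^ (l%:Z - k%:Z)).
  case: (val_ring_cases P ((c' / c) ^+ e * pi ^ (l%:Z - k%:Z))) => [Ic|[//|[x0 Ix]]].
    by move: rc; rewrite edge_res_inf // eqxx.
  by case: (val_ring_infV Ix x0).
have wE i (j : nat) : ((p i)`_j / c') ^+ e * pi ^ (j%:Z - l%:Z) =
    ((p i)`_j / c) ^+ e * pi ^ (j%:Z - k%:Z) * ((c' / c) ^+ e * pi ^ (l%:Z - k%:Z))^-1.
  rewrite -weightV -weightM //; congr (_ ^+ e * _ ^ _); last by lia.
  by rewrite invf_div mulrA divfK.
have sv i (j : nat) : vertex_val P pi e s ((p i)`_j / c') (j%:Z - l%:Z).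
  rewrite /vertex_val wE; case: (Uc) => _ Uc'; split; first by apply: val_ringM => //; apply: scE.
  move=> sj; apply: infinitesimalMr => //; apply: (edge_res_eq0 e0 emin); first exact: scE.
  by have := rlow i j sj; rewrite coef_rpoly.
have Oc i : O ((p i)`_l / c').
  by have := sv i l; rewrite subrr; apply: vertex_val_res.
have nl : normal l c' by split=> //; exists i1; rewrite divff // residue1 oner_eq0.
have sl : sg l c' != 0.
  pose V := vertex_place P pi0 e0 s0.
  have rV i : rpoly V c' l (p i) = (res ((p i)`_l / c')) *: 'X^l.
    apply/polyP => j; rewrite coef_rpoly coefZ coefXn /= /vertex_res subr_eq0 eqz_nat.
    by case: eqP => [->|]; rewrite ?mulr1 ?mulr0.
  have sV i : scaled V c' l (p i) by move=> j; apply: sv.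
  have rV1 : rpoly V c' l (p i1) != 0.
    by rewrite rV divff // residue1 scale1r -size_poly_eq0 size_polyXn.
  have [Q Q0 Qnz] := nonvanishing c'0 sV rV1.
  have [w w0 /(_ 1 ltr01) /Qnz] := generic_ray Q0.
  rewrite rmorph1 mul1r; apply: contra => /eqP sl0.
  rewrite (eq_bigr (fun i => d i * nsq (res ((p i)`_l / c')) * nsq (w ^+ l))).
    by rewrite -mulr_suml -/(sg _ _) sl0 mul0r.
  by move=> i _; rewrite rV hornerZ hornerXn nsqM mulrA.
split=> //; exists (nsq (edge_res P pi e (c' / c) (l%:Z - k%:Z))); first exact: nsq_gt0.
rewrite /sg mulr_suml; apply: eq_bigr => i _; rewrite -mulrA -nsqM; congr (_ * nsq _).
rewrite coef_rpoly /=.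
have -> : res ((p i)`_l / c') = edge_res P pi e ((p i)`_l / c') 0.
  by rewrite /edge_res dvdz0 div0z expr0z mulr1.
rewrite -edge_resM //; last by rewrite /edge_val expr0z mulr1; apply: val_ringX.
by rewrite add0r mulrA divfK.
Qed.

(** The weak inequality at [kh] becomes strict by non-vanishing at the vertex; [sign_lowest_highest]
    then carries it along the edge. *)
Lemma edge_sign l kh ckh i1 i2 :
    (rp i1)`_l != 0 -> (forall i j, (j < l)%N -> (rp i)`_j = 0) ->
    (rp i2)`_kh != 0 -> (forall i j, (kh < j)%N -> (rp i)`_j = 0) ->
    normal kh ckh -> 0 <= sg kh ckh ->
  exists cl, [/\ normal l cl, 0 < sg l cl &
    forall i j, vertex_val P pi e 1 ((p i)`_j / cl) (j%:Z - l%:Z)].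
Proof.
move=> r1 rlow r2 rhigh nkh skh.
have [||cl [nl sl [t t0 tE] vl]] := @edge_vertex 1 l i1 _ r1; first by [].
  by move=> i j; rewrite mul1r subr_lt0 ltz_nat; apply: rlow.
have [||ch [nh sh [u u0 uE] _]] := @edge_vertex (-1) kh i2 _ r2; first by [].
  by move=> i j; rewrite mulN1r opprB subr_lt0 ltz_nat; apply: rhigh.
exists cl; split=> //; rewrite -(pmulr_lgt0 _ t0) -tE.
have ri1 : rpoly E c k (p i1) != 0 by apply: contra r1 => /eqP ->; rewrite coef0.
have [Q Q0 Qnz] := nonvanishing c0 scE ri1.
apply: (sign_lowest_highest Q0 Qnz _ rlow rhigh).
- by rewrite leqNgt; apply/negP => khl; rewrite (rhigh i1 l khl) eqxx in r1.
- have [v v0 vE] := sg_rescale nkh nh.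
  by rewrite uE mulr_gt0 // lt_def sh vE mulr_ge0 // ltW.
by rewrite tE mulf_neq0 // gt_eqF.
Qed.

End Edge.

(* Every slope for which some index below [k] matters is steep enough for the
   indices above [k] to be negligible. *)
Definition above_negligible k c := forall pi e, pi != 0 -> (0 < e)%N ->
  (exists i l, (l < k)%N /\ ~ Inf (((p i)`_l / c) ^+ e * pi ^ (l%:Z - k%:Z))) ->
  forall i j, (k < j)%N -> Inf (((p i)`_j / c) ^+ e * pi ^ (j%:Z - k%:Z)).

(** An index [l' < l] has positive weight for the slope [v(pi) / e]. If it matters for the slope
    [v(pi1) / e1], the latter is larger, and an index [j > l] of weight at least 0 for the first
    slope has positive weight for the second. *)
Lemma above_negligible_vertex pi e l c : pi != 0 -> (0 < e)%N -> c != 0 ->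
  (forall i j, vertex_val P pi e 1 ((p i)`_j / c) (j%:Z - l%:Z)) -> above_negligible l c.
Proof.
move=> p0 e0 c0 V pi1 e1 p10 e10 [i1 [l' [l'l nI]]] i j lj.
have [_ ] := V i1 l'; rewrite mul1r subr_lt0 ltz_nat => /(_ l'l).
have [+ _] := V i j; move: nI.
set x := (p i1)`_l' / c; set z := (p i)`_j / c => nI Oz Ix; clearbody x z.
have [a [a0 aE]] : exists a, (0 < a)%N /\ l'%:Z - l%:Z = - a%:Z by exists (l - l')%N; lia.
have [b [b0 bE]] : exists b, (0 < b)%N /\ j%:Z - l%:Z = b%:Z by exists (j - l)%N; lia.
rewrite {}aE -!exprnN in nI Ix; rewrite {}bE -exprnP in Oz *.
have x0 : x != 0.
  by apply/eqP => x0; apply: nI; rewrite x0 expr0n eqn0Ngt e10 mul0r; apply: infinitesimal0.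
have O1 : O (x^-1 ^+ e1 * pi1 ^+ a).
  have -> : x^-1 ^+ e1 * pi1 ^+ a = (x ^+ e1 / pi1 ^+ a)^-1 by rewrite [RHS]invf_div exprVn mulrC.
  by case: (val_ring_cases P (x ^+ e1 / pi1 ^+ a)) => [//|[[]//|[_ []]]].
(* The exponent [e * a] clears denominators: the new weight of [z] becomes a combination, with
   natural multiplicities, of its old weight, the positive old weight of [x] and the opposite of the
   new weight of [x]. *)
apply: (@infinitesimal_root _ _ _ _ _ (e * a)%N); first by rewrite muln_gt0 e0.
have -> : (z ^+ e1 * pi1 ^+ b) ^+ (e * a) =
  (z ^+ e * pi ^+ b) ^+ (e1 * a) * ((x ^+ e / pi ^+ a) ^+ (e1 * b) * (x^-1 ^+ e1 * pi1 ^+ a) ^+ (e * b)).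
  rewrite !exprMn !exprVn -!exprM.
  have -> : (e1 * (e * a) = e * (e1 * a))%N by lia.
  have -> : (b * (e * a) = a * (e * b))%N by lia.
  have -> : (b * (e1 * a) = a * (e1 * b))%N by lia.
  have -> : (e1 * (e * b) = e * (e1 * b))%N by lia.
  set A := z ^+ _; set B := pi1 ^+ _; set D := pi ^+ _; set F := x ^+ _.
  by field; rewrite !expf_neq0.
apply: infinitesimalMl; first exact: val_ringX.
apply: infinitesimalMr; last exact: val_ringX.
by apply: infinitesimalX => //; rewrite muln_gt0 e10.
Qed.

Lemma cross_ratio (x y z : K) a b c : x != 0 -> y != 0 ->
  (z ^+ a / x ^+ c) ^+ b = (z ^+ b / y ^+ c) ^+ a * (y ^+ a / x ^+ b) ^+ c.
Proof.
move=> x0 y0; rewrite !exprMn !exprVn -!exprM (mulnC b a) (mulnC c a) (mulnC c b).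
by field; rewrite !expf_neq0.
Qed.

Lemma walk_step k c i0 : (p i0)`_0 != 0 -> (0 < k)%N -> normal k c -> 0 <= sg k c ->
    above_negligible k c ->
  exists l c', [/\ (l < k)%N, normal l c', 0 < sg l c' & above_negligible l c'].
Proof.
move=> pi00 k0 nk sk up; case: (nk) => c0 Oc [i2 ri2].
pose y (u : 'I_I * nat) := (p u.1)`_u.2 / c.
pose s := [seq u <- [seq (i, l) | i <- enum 'I_I, l <- seq.iota 0 k] | (p u.1)`_u.2 != 0].
have sP u : u \in s = (u.2 < k)%N && ((p u.1)`_u.2 != 0).
  rewrite mem_filter andbC; congr (_ && _); apply/allpairsP/idP => [[[i l] /= [_ + ->]]|uk].
    by rewrite mem_iota.
  by exists u; rewrite mem_enum mem_iota -surjective_pairing.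
have yn0 u : u \in s -> y u != 0.
  by rewrite sP => /andP [_ pu]; rewrite mulf_neq0 ?invr_eq0.
(* This compares [val(y u) / (k - u.2)] with [val(y v) / (k - v.2)], denominators cleared. The least
   of these slopes belongs to the edge of the Newton polygon that leaves [k] to the left. *)
pose le u v := O (y v ^+ (k - u.2) / y u ^+ (k - v.2)).
have [u us umin] : exists2 u, u \in s & forall v, v \in s -> le u v.
  apply: seq_min_total.
  - apply/eqP => s0; have : (i0, 0%N) \in s by rewrite sP /= k0.
    by rewrite s0.
  - move=> u v us vs; rewrite /le.
    by case: (val_ring_total P (y v ^+ (k - u.2) / y u ^+ (k - v.2))) => [|[]]; [left|rewrite invf_div; right].
  - move=> u v w us vs ws uv vw.
    have pos t : t \in s -> (0 < k - t.2)%N by rewrite sP subn_gt0 => /andP [].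
    apply: (@val_ring_root _ _ _ _ _ (k - v.2)); first exact: pos.
    rewrite (cross_ratio _ (k - u.2)%N (k - v.2)%N (k - w.2)%N (yn0 u us) (yn0 v vs)).
    by apply: val_ringM; apply: val_ringX.
have pos t : t \in s -> (0 < k - t.2)%N by rewrite sP subn_gt0 => /andP [].
have lek t : t \in s -> t.2%:Z - k%:Z = - (k - t.2)%N%:Z.
  by rewrite sP => /andP [tk _]; lia.
(* For the slope given by [y u] and [k - u.2], the indices [u.2] and [k] have the same weight 0. *)
have [pi [e [pi0 e0 emin eqv]]] := minimal_slope P (yn0 u us) (pos u us).
have wle t : t \in s -> O (y t ^+ e * pi ^ (t.2%:Z - k%:Z)).
  move=> ts; apply/(proj1 (eqv _ _ (yn0 t ts))).
  by rewrite lek // -exprnN; apply: umin.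
have wu : ~ Inf (y u ^+ e * pi ^ (u.2%:Z - k%:Z)).
  move/(proj2 (eqv _ _ (yn0 u us))); rewrite lek // -exprnN divff ?expf_neq0 ?yn0 //.
  exact: infinitesimal1.
have uk : (u.2 < k)%N by move: us; rewrite sP => /andP [].
have upk i j : (k < j)%N -> Inf (((p i)`_j / c) ^+ e * pi ^ (j%:Z - k%:Z)).
  by apply: up => //; exists u.1, u.2.
pose E := edge_place pi0 e0 emin.
have scE i : scaled E c k (p i).
  move=> j; rewrite /= /edge_val; have [jk|kj|->] := ltngtP j k.
  - have [->|pij] := eqVneq (p i)`_j 0.
      by rewrite mul0r expr0n eqn0Ngt e0 mul0r; apply: val_ring0.
    by apply: (wle (i, j)); rewrite sP jk.
  - by case: (upk i j kj).
  by rewrite subrr expr0z mulr1; apply: val_ringX.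
have ru : (rpoly E c k (p u.1))`_u.2 != 0.
  rewrite coef_rpoly; apply/eqP => r0; apply: wu.
  by apply: (edge_res_eq0 e0 emin) => //; apply: wle.
have rk : (rpoly E c k (p i2))`_k != 0.
  by rewrite coef_rpoly subrr /= /edge_res dvdz0 div0z expr0z mulr1.
have rhigh i j : (k < j)%N -> (rpoly E c k (p i))`_j = 0.
  by move=> kj; rewrite coef_rpoly; apply: edge_res_inf => //; apply: upk.
(* [u] may lie inside the edge; its left end is the least index with a nonzero residue. *)
have [l [lu [i1 ri1] rlow]] : exists l, [/\ (l <= u.2)%N,
    exists i, (rpoly E c k (p i))`_l != 0 &
    forall i j, (j < l)%N -> (rpoly E c k (p i))`_j = 0].
  pose Q j := [exists i, (rpoly E c k (p i))`_j != 0].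
  have [|l /existsP [i ri] lmin] := @ex_minnP Q.
    by exists u.2; apply/existsP; exists u.1.
  exists l; split; [by apply: lmin; apply/existsP; exists u.1|by exists i|].
  move=> i' j jl; apply/eqP; rewrite -[_ == 0]negbK; apply/negP => rj.
  by have := lmin j; rewrite leqNgt jl => /(_ _)/negP []//; apply/existsP; exists i'.
have [c' [nl sl vl]] := edge_sign c0 scE ri1 rlow rk rhigh nk sk.
exists l, c'; split=> //; first exact: leq_ltn_trans uk.
by apply: (above_negligible_vertex pi0 e0 _ vl); case: nl.
Qed.

(** The case of a walk without edges: non-vanishing is applied with the trivial slope [pi = 1],
    where all residue polynomials are constant. *)
Lemma sg0_neq0 c : normal 0 c -> (forall i, (size (p i) <= 1)%N) -> sg 0 c != 0.
Proof.
move=> [c0 Oc [i ri]] szp; pose V := vertex_place P (oner_neq0 K) (ltn0Sn 0) (oner_neq0 int).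
have pE j k : (p j)`_k.+1 = 0 by rewrite nth_default // (leq_trans (szp j)).
have rV j : rpoly V c 0 (p j) = (res ((p j)`_0 / c))%:P.
  apply/polyP => -[|k]; rewrite coef_rpoly coefC /= /vertex_res //.
have sV j : scaled V c 0 (p j).
  move=> [|k] /=; last by rewrite pE mul0r; apply: vertex_val0.
  by split=> //; rewrite subrr expr0z mulr1 expr1.
have [|Q Q0 Qnz] := nonvanishing c0 sV (i0 := i); first by rewrite rV polyC_eq0.
have [w w0 /(_ 1 ltr01) /Qnz] := generic_ray Q0.
by under eq_bigr do rewrite rV hornerC.
Qed.

(** Nothing lies above the top index, so the walk can start there. As long as the index is positive,
    the nonzero constant coefficient of [p i0] provides a further edge to the left. *)
Lemma sign_walk k c i0 : (p i0)`_0 != 0 -> normal k c -> 0 <= sg k c ->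
  (forall i, (size (p i) <= k.+1)%N) -> exists2 c', normal 0 c' & 0 < sg 0 c'.
Proof.
move=> pi00 nk sk szp.
have: above_negligible k c.
  move=> pi e p0 e0 _ i j kj; rewrite nth_default ?(leq_trans (szp i)) //.
  by rewrite mul0r expr0n eqn0Ngt e0 mul0r; apply: infinitesimal0.
case: k c nk sk szp => [|k] c nk sk szp up.
  by exists c => //; rewrite lt_def sk sg0_neq0.
have [l [c' [_ nl sl upl]]] := walk_step pi00 (ltn0Sn k) nk sk up.
elim/ltn_ind: l c' nl sl upl {nk sk szp up} => -[|l] IH c' nl sl up; first by exists c'.
have [l' [c'' [l'l nl' sl' upl']]] := walk_step pi00 (ltn0Sn l) nl (ltW sl) up.
exact: IH l'l c'' nl' sl' upl'.
Qed.

End Walk.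

(** * Maximal cones and the places they define *)

Section HermitianCones.
Variables (R : realType) (A Z : idomainType).
Variables (cA : {rmorphism R[i] -> A}) (rc : {rmorphism R -> Z}).
Variables (hol : {rmorphism A -> Z}) (star : {rmorphism Z -> Z}).
Hypothesis starK : involutive star.
Hypothesis star_rc : forall c, star (rc c) = rc c.

(** For polynomials in [z] and [wbar] this is [f(z)] times the conjugate of [f(w)]: [star]
    conjugates the coefficients and exchanges the two groups of variables. *)
Definition hnorm f : Z := hol f * star (hol f).
Hypothesis hnorm_cA : forall c, hnorm (cA c) = rc (nsq c).
Hypothesis hol_real : forall c : R, hol (cA c%:C%C) = rc c /\ star (hol (cA c%:C%C)) = rc c.
Hypothesis hnorm_sum_eq0 : forall s : seq A, \sum_(f <- s) hnorm f = 0 ->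
  forall f, f \in s -> f = 0.

Definition selfadj a := star a = a.
Definition sos a := exists s : seq A, a = \sum_(f <- s) hnorm f.

Lemma hnormM f g : hnorm (f * g) = hnorm f * hnorm g.
Proof. by rewrite /hnorm !rmorphM mulrACA. Qed.

Lemma sos0 : sos 0. Proof. by exists [::]; rewrite big_nil. Qed.

Lemma sos_hnorm f : sos (hnorm f).
Proof. by exists [:: f]; rewrite big_seq1. Qed.

Lemma sosD a b : sos a -> sos b -> sos (a + b).
Proof. by move=> [s ->] [t ->]; exists (s ++ t); rewrite big_cat. Qed.

Lemma sosM a b : sos a -> sos b -> sos (a * b).
Proof.
move=> [s ->] [t ->]; exists [seq f * g | f <- s, g <- t].
rewrite big_allpairs_dep mulr_suml; apply: eq_bigr => f _.
by rewrite mulr_sumr; apply: eq_bigr => g _; rewrite hnormM.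
Qed.

Lemma sos_rc c : 0 <= c -> sos (rc c).
Proof.
move=> c0; exists [:: cA (Num.sqrt c)%:C%C]; rewrite big_seq1 hnorm_cA.
by rewrite /nsq /= expr0n addr0 sqr_sqrtr.
Qed.

Lemma sos1 : sos 1. Proof. by rewrite -(rmorph1 rc); apply: sos_rc. Qed.

Lemma sos_selfadj a : sos a -> selfadj a.
Proof.
move=> [s ->]; rewrite /selfadj rmorph_sum; apply: eq_bigr => f _.
by rewrite rmorphM /= starK mulrC.
Qed.

Lemma sosD_eq0 a b : sos a -> sos b -> a + b = 0 -> a = 0.
Proof.
move=> [s ->] [t ->]; rewrite -big_cat => /hnorm_sum_eq0 st0.
rewrite big_seq big1 // => f fs; rewrite (st0 f) ?mem_cat ?fs //.
by rewrite /hnorm rmorph0 mul0r.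
Qed.

Lemma hnorm_neq0 f : f != 0 -> hnorm f != 0.
Proof.
apply: contra => /eqP f0; apply/eqP/(@hnorm_sum_eq0 [:: f]); last exact: mem_head.
by rewrite big_seq1.
Qed.

Lemma rc_eq0 c : (rc c == 0) = (c == 0).
Proof. by rewrite fmorph_eq0. Qed.

Record cone (M : Z -> Prop) : Prop := Cone {
  cone_selfadj : forall a, M a -> selfadj a;
  cone_sos : forall a, sos a -> M a;
  coneD : forall a b, M a -> M b -> M (a + b);
  cone_sosM : forall t a, sos t -> M a -> M (t * a);
  cone_proper : forall g, sos g -> g != 0 -> ~ M (- g) }.

Lemma maximal_cone M0 : cone M0 -> exists M, [/\ cone M, forall a, M0 a -> M a &
  forall M', cone M' -> (forall a, M a -> M' a) -> forall a, M' a -> M a].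
Proof.
move=> cM0; pose P (X : set Z) := X = set0 \/ (cone X /\ forall a, M0 a -> X a).
have [F FP Ftot|M [PM Mmax]] := @Zorn_bigcup Z P.
  have [[X0 FX0 [a0 X0a0]]|Fe] := pselect (exists2 X, F X & exists a, X a); last first.
    left; apply/seteqP; split=> // a [X FX Xa].
    by case: Fe; exists X => //; exists a.
  have good X a : F X -> X a -> cone X /\ forall a, M0 a -> X a.
    by move=> FX Xa; case: (FP X FX) => // X0e; rewrite X0e in Xa.
  have [cX0 M0X0] := good _ _ FX0 X0a0.
  right; split=> [|a M0a]; last by exists X0 => //; apply: M0X0.
  split.
  - by move=> a [X FX Xa]; case: (good _ _ FX Xa) => cX _; apply: (cone_selfadj cX).
  - by move=> a sa; exists X0 => //; apply: (cone_sos cX0).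
  - move=> a b [X FX Xa] [Y FY Yb].
    have [XY|YX] := Ftot _ _ FX FY.
      by exists Y => //; case: (good _ _ FY Yb) => cY _; apply: (coneD cY) => //; apply: XY.
    by exists X => //; case: (good _ _ FX Xa) => cX _; apply: (coneD cX) => //; apply: YX.
  - move=> t a st [X FX Xa]; exists X => //.
    by case: (good _ _ FX Xa) => cX _; apply: (cone_sosM cX).
  - move=> g sg g0 [X FX Xg].
    by case: (good _ _ FX Xg) => cX _; apply: (cone_proper cX sg g0).
case: PM => [M0e|[cM M0M]].
  case: (Mmax M0); last by right.
  by rewrite M0e; split=> // /(_ 0 (cone_sos cM0 sos0)).
exists M; split=> // M' cM' MM' a M'a; apply: contrapT => nMa.
apply: (Mmax M'); last by right; split=> // b /M0M /MM'.
by split=> // /(_ a M'a).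
Qed.

Lemma nonquotient_cone r : selfadj r ->
  ~ (exists g, [/\ sos g, g != 0 & sos (r * g)]) ->
  exists M, [/\ cone M, M (- r) & forall M', cone M' -> (forall a, M a -> M' a) ->
    forall a, M' a -> M a].
Proof.
(* The cone generated by the squared norms and [- r]. An equation [- g = a - r * b] would exhibit
   [r] as the quotient of [a + g] by [b]. *)
move=> hr nr; pose M0 x := exists a b, [/\ sos a, sos b & x = a - r * b].
have [|M [cM M0M Mmax]] := @maximal_cone M0.
  split.
  - move=> _ [a [b [sa sb ->]]].
    by rewrite /selfadj rmorphB rmorphM /= hr !sos_selfadj.
  - by move=> a sa; exists a, 0; split=> //; [exact: sos0|rewrite mulr0 subr0].
  - move=> _ _ [a [b [sa sb ->]]] [a' [b' [sa' sb' ->]]].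
    by exists (a + a'), (b + b'); split; [exact: sosD|exact: sosD|ring].
  - move=> t _ st [a [b [sa sb ->]]].
    by exists (t * a), (t * b); split; [exact: sosM|exact: sosM|ring].
  move=> g sg g0 [a [b [sa sb gE]]]; apply: nr; exists b.
  have rbE : r * b = a + g by apply/eqP; rewrite -subr_eq0 opprD addrA gE; apply/eqP; ring.
  split=> //; last by rewrite rbE; apply: sosD.
  apply/eqP => b0; move/eqP: g0; apply; apply: (sosD_eq0 sg sa).
  by rewrite addrC -rbE b0 mulr0.
exists M; split=> //; apply: M0M; exists 0, 1.
by split; [exact: sos0|exact: sos1|rewrite mulr1 sub0r].
Qed.

Section MaximalCone.
Variable M : Z -> Prop.
Hypotheses (cM : cone M) (Mmax : forall M', cone M' -> (forall a, M a -> M' a) ->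
  forall a, M' a -> M a).

Let MD := coneD cM.
Let Msos := cone_sos cM.
Let MsosM := cone_sosM cM.
Let Mproper := cone_proper cM.

Lemma cone_rcM c a : 0 <= c -> M a -> M (rc c * a).
Proof. by move=> c0; apply: MsosM; apply: sos_rc. Qed.

(** By maximality, adjoining [a] to [M] must destroy properness. *)
Lemma maximal_cone_out a : selfadj a -> ~ M a ->
  exists g s t, [/\ sos g, g != 0, M s, sos t & - g = s + t * a].
Proof.
move=> ha nMa; apply: contrapT => H; apply: nMa.
pose M' x := exists s t, [/\ M s, sos t & x = s + t * a].
apply: (Mmax (M' := M')); last first.
- by exists 0, 1; split; [exact: Msos sos0|exact: sos1|rewrite mul1r add0r].
- by move=> x Mx; exists x, 0; split; [|exact: sos0|rewrite mul0r addr0].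
split.
- move=> _ [s [t [Ms st ->]]]; rewrite /selfadj rmorphD rmorphM /= ha.
  by rewrite (cone_selfadj cM Ms) sos_selfadj.
- by move=> x sx; exists x, 0; split; [exact: Msos|exact: sos0|rewrite mul0r addr0].
- move=> _ _ [s [t [Ms st ->]]] [s' [t' [Ms' st' ->]]].
  by exists (s + s'), (t + t'); split; [exact: MD|exact: sosD|ring].
- move=> u _ su [s [t [Ms st ->]]].
  by exists (u * s), (u * t); split; [exact: MsosM|exact: sosM|ring].
by move=> g sg g0 [s [t [Ms st gE]]]; apply: H; exists g, s, t.
Qed.

(** The failures [- g = s + t * a] and [- g' = s' - t' * a] are combined so that [a] cancels.
    Properness then gives [t * g' = 0], so [t = 0] and [- g = s] lies in [M]. *)
Lemma maximal_cone_total a : selfadj a -> M a \/ M (- a).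
Proof.
move=> ha; have [|nMa] := pselect (M a); first by left.
have [|nMNa] := pselect (M (- a)); first by right.
have hNa : selfadj (- a) by rewrite /selfadj rmorphN ha.
have [g [s [t [sg g0 Ms st gE]]]] := maximal_cone_out ha nMa.
have [g' [s' [t' [sg' g'0 Ms' st' g'E]]]] := maximal_cone_out hNa nMNa.
have E : - (t' * g + t * g') = t' * s + t * s'.
  have -> : t' * s + t * s' = t' * (s + t * a) + t * (s' + t' * - a) by ring.
  by rewrite -gE -g'E; ring.
have st1 := sosM st' sg; have st2 := sosM st sg'.
have tg0 : t' * g + t * g' = 0.
  apply/eqP; rewrite -[_ == 0]negbK; apply/negP => tg.
  apply: (Mproper (sosD st1 st2) tg); rewrite E.
  by apply: MD; apply: MsosM.
have /eqP : t * g' = 0 by apply: (sosD_eq0 st2 st1); rewrite addrC.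
rewrite mulf_eq0 (negbTE g'0) orbF => /eqP t0.
by case: (Mproper sg g0); rewrite gE t0 mul0r addr0.
Qed.

(** The elements that some nonzero sum of squared norms multiplies into [M] form a cone containing
    [M]. This makes comparisons independent of the chosen numerator and denominator. *)
Lemma maximal_cone_saturated t a : sos t -> t != 0 -> selfadj a -> M (t * a) -> M a.
Proof.
move=> st t0 ha Mta; pose M' x := selfadj x /\ exists u, [/\ sos u, u != 0 & M (u * x)].
apply: (Mmax (M' := M')); last by split=> //; exists t.
  split.
  - by move=> x [].
  - move=> x sx; split; first exact: sos_selfadj.
    by exists 1; split; [exact: sos1|exact: oner_neq0|rewrite mul1r; apply: Msos].
  - move=> x y [hx [u [su u0 Mu]]] [hy [v [sv v0 Mv]]].
    split; first by rewrite /selfadj rmorphD hx hy.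
    exists (u * v); split; [exact: sosM|exact: mulf_neq0|].
    have -> : u * v * (x + y) = v * (u * x) + u * (v * y) by ring.
    by apply: MD; apply: MsosM.
  - move=> s x ss [hx [u [su u0 Mu]]].
    split; first by rewrite /selfadj rmorphM /= hx sos_selfadj.
    by exists u; split=> //; rewrite mulrCA; apply: MsosM.
  move=> g sg g0 [_ [u [su u0]]]; rewrite mulrN.
  by apply: Mproper; [exact: sosM|exact: mulf_neq0].
move=> x Mx; split; first exact: (cone_selfadj cM).
by exists 1; split; [exact: sos1|exact: oner_neq0|rewrite mul1r].
Qed.

Lemma cone_rc_ge0 u q : sos u -> u != 0 -> M (rc q * u) -> 0 <= q.
Proof.
move=> su u0 Mq; rewrite leNgt; apply/negP => q0.
apply: (@Mproper (rc (- q) * u)).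
- by apply: sosM => //; apply: sos_rc; rewrite oppr_ge0 ltW.
- by rewrite mulf_neq0 // rc_eq0 oppr_eq0 lt_eqF.
by rewrite rmorphN mulNr opprK.
Qed.

Lemma hnorm_selfadj f : selfadj (hnorm f).
Proof. exact/sos_selfadj/sos_hnorm. Qed.

Lemma selfadj_rcM c a : selfadj a -> selfadj (rc c * a).
Proof. by move=> ha; rewrite /selfadj rmorphM /= star_rc ha. Qed.

Lemma selfadjB a b : selfadj a -> selfadj b -> selfadj (a - b).
Proof. by move=> ha hb; rewrite /selfadj rmorphB ha hb. Qed.

(* [std u a q]: the quotient [a / u] has standard part [q] for the order of [M]. *)
Definition std u a q := forall e, 0 < e -> M (rc (q + e) * u - a) /\ M (a - rc (q - e) * u).

(** The standard part is a supremum: completeness of [R] enters here and makes [R[i]] the residue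
    field. *)
Lemma std_exists u a c : sos u -> u != 0 -> selfadj a ->
  M (rc c * u - a) -> M (rc c * u + a) -> exists q, std u a q.
Proof.
move=> su u0 ha Mc MNc; pose S : set R := fun q => M (a - rc q * u).
have hu := sos_selfadj su.
have Sc : S (- c) by rewrite /S /= rmorphN mulNr opprK addrC.
have Sub : ubound S c.
  move=> q Sq; rewrite -subr_ge0; apply: (cone_rc_ge0 su u0).
  have -> : rc (c - q) * u = (rc c * u - a) + (a - rc q * u) by ring.
  exact: MD.
have hS : has_sup S by split; [exists (- c)|exists c].
exists (sup S) => e e0; split.
  have hS' : selfadj (rc (sup S + e) * u - a).
    by apply: selfadjB => //; apply: selfadj_rcM.
  have [//|Mn] := maximal_cone_total hS'.
  have /(ub_le_sup hS.2) : S (sup S + e) by rewrite /S /= -opprB.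
  by rewrite gerDl leNgt e0.
have [q Sq qe] := sup_adherent e0 hS.
have -> : a - rc (sup S - e) * u = (a - rc q * u) + rc (q - (sup S - e)) * u by ring.
by apply: MD => //; apply: cone_rcM; [rewrite subr_ge0 ltW|exact: Msos].
Qed.

Lemma stdD u a b p q : std u a p -> std u b q -> std u (a + b) (p + q).
Proof.
move=> sa sb e e0; have e20 : 0 < e / 2 by rewrite divr_gt0.
have [a1 a2] := sa _ e20; have [b1 b2] := sb _ e20; split.
  have -> : rc (p + q + e) * u - (a + b) = (rc (p + e / 2) * u - a) + (rc (q + e / 2) * u - b).
    by rewrite {1}(splitr e); ring.
  exact: MD.
have -> : a + b - rc (p + q - e) * u = (a - rc (p - e / 2) * u) + (b - rc (q - e / 2) * u).
  by rewrite {1}(splitr e); ring.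
exact: MD.
Qed.

Lemma stdN u a q : std u a q -> std u (- a) (- q).
Proof.
move=> sa e e0; have [a1 a2] := sa _ e0; split.
  by have -> : rc (- q + e) * u - - a = a - rc (q - e) * u by ring.
by have -> : - a - rc (- q - e) * u = rc (q + e) * u - a by ring.
Qed.

Lemma std_rc u c : sos u -> std u (rc c * u) c.
Proof.
move=> su e e0; split.
  have -> : rc (c + e) * u - rc c * u = rc e * u by ring.
  by apply: cone_rcM; [exact: ltW|exact: Msos].
have -> : rc c * u - rc (c - e) * u = rc e * u by ring.
by apply: cone_rcM; [exact: ltW|exact: Msos].
Qed.

Lemma std_rcM u a q c : std u a q -> std u (rc c * a) (c * q).
Proof.
suff H b p k : 0 < k -> std u b p -> std u (rc k * b) (k * p).
  move=> sa; have [c0|c0|->] := ltgtP c 0; last 1 first.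
  - rewrite rmorph0 !mul0r => e e0.
    have [a1 a2] := sa (e / 2) (divr_gt0 e0 (ltr0n _ 2)).
    have Mu : M (rc e * u).
      have -> : rc e * u = (rc (q + e / 2) * u - a) + (a - rc (q - e / 2) * u).
        by rewrite {1}(splitr e); ring.
      exact: MD.
    by split; [have -> : rc (0 + e) * u - 0 = rc e * u by ring|
      have -> : 0 - rc (0 - e) * u = rc e * u by ring].
  - have := H _ _ (- c) _ (stdN sa); rewrite oppr_gt0 => /(_ c0).
    by rewrite rmorphN !mulrNN.
  exact: H.
move=> k0 sb e e0; have [b1 b2] := sb (e / k) (divr_gt0 e0 k0).
have ek : e = k * (e / k) by rewrite mulrC divfK // gt_eqF.
split.
  have -> : rc (k * p + e) * u - rc k * b = rc k * (rc (p + e / k) * u - b).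
    by rewrite {1}ek; ring.
  by apply: cone_rcM => //; apply: ltW.
have -> : rc k * b - rc (k * p - e) * u = rc k * (b - rc (p - e / k) * u).
  by rewrite {1}ek; ring.
by apply: cone_rcM => //; apply: ltW.
Qed.

Lemma std_unique u a p q : sos u -> u != 0 -> std u a p -> std u a q -> p = q.
Proof.
move=> su u0; suff H p' q' : std u a p' -> std u a q' -> p' <= q'.
  by move=> sp sq; apply/le_anti; rewrite !H.
move=> sp sq; apply/ler_addgt0Pr => e e0.
have e20 : 0 < e / 2 by rewrite divr_gt0.
have [_ a1] := sp _ e20; have [a2 _] := sq _ e20.
rewrite -subr_ge0; apply: (cone_rc_ge0 su u0).
have -> : rc (q' + e - p') * u = (rc (q' + e / 2) * u - a) + (a - rc (p' - e / 2) * u).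
  by rewrite {1}(splitr e); ring.
exact: MD.
Qed.

Lemma std_ge0 u a q : sos u -> u != 0 -> std u a q -> M a -> 0 <= q.
Proof.
move=> su u0 sa Ma; apply/ler_addgt0Pr => e e0.
have [a1 _] := sa _ e0; apply: (cone_rc_ge0 su u0).
by rewrite -(subrK a (_ * u)); apply: MD.
Qed.

(** [M] absorbs products with sums of squared norms, hence the restriction on [t] and [t']. *)
Lemma stdM u t q u' t' q' : sos u -> sos t -> sos u' -> sos t' -> 0 <= q -> 0 <= q' ->
  std u t q -> std u' t' q' -> std (u * u') (t * t') (q * q').
Proof.
move=> su st su' st' q0 q'0 sq sq' e e0.
pose k := q + q' + 1; have k0 : 0 < k by rewrite /k; lra.
(* As [d <= 1], two approximations within [d] have a product within
   [d * (q + q' + d) <= d * k <= e]. *)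
pose d := Num.min 1 (e / k).
have d0 : 0 < d by rewrite /d lt_min ltr01 divr_gt0.
have d1 : d <= 1 by rewrite /d ge_min lexx.
have dk : d * k <= e by rewrite -ler_pdivlMr // /d ge_min lexx orbT.
have [t1 t2] := sq _ d0; have [t'1 t'2] := sq' _ d0.
have suu := sosM su su'; split.
  have -> : rc (q * q' + e) * (u * u') - t * t' =
      t' * (rc (q + d) * u - t) + (rc (q + d) * u) * (rc (q' + d) * u' - t') +
      rc (q * q' + e - (q + d) * (q' + d)) * (u * u') by ring.
  apply: MD; first apply: MD.
  - exact: MsosM.
  - apply: MsosM => //; apply: sosM => //; apply: sos_rc.
    by rewrite addr_ge0 // ltW.
  apply: cone_rcM; last exact: Msos.
  rewrite subr_ge0; apply: le_trans (_ : q * q' + d * k <= _); last by rewrite lerD2l.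
  by rewrite /k; nra.
(* [q - d] may be negative and is then no admissible multiplier; the terms [q u t'] and [d u t'] are
   estimated separately. *)
have -> : t * t' - rc (q * q' - e) * (u * u') =
    t' * (t - rc (q - d) * u) + (rc q * u) * (t' - rc (q' - d) * u') +
    rc d * (u * (rc (q' + d) * u' - t')) +
    rc (q * (q' - d) - d * (q' + d) - (q * q' - e)) * (u * u') by ring.
apply: MD; first apply: MD; first apply: MD.
- exact: MsosM.
- by apply: MsosM => //; apply: sosM => //; apply: sos_rc.
- by apply: cone_rcM; [exact: ltW|exact: MsosM].
apply: cone_rcM; last exact: Msos.
have : d * d <= d by rewrite ger_pMr.
by move: dk; rewrite /k; nra.
Qed.


(** Twice the real part of the Hermitian product of [f] and [g]. *)
Definition hdot f g : Z := hol f * star (hol g) + hol g * star (hol f).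

Lemma hdot_selfadj f g : selfadj (hdot f g).
Proof. by rewrite /selfadj /hdot rmorphD !rmorphM /= !starK addrC mulrC; congr (_ + _); rewrite mulrC. Qed.

Lemma hnormD f g : hnorm (f + g) = hnorm f + hnorm g + hdot f g.
Proof. by rewrite /hnorm /hdot !rmorphD /=; ring. Qed.

Lemma hnormB f g : hnorm (f - g) = hnorm f + hnorm g - hdot f g.
Proof. by rewrite /hnorm /hdot !rmorphB /=; ring. Qed.

Lemma hdot_cA c k : hdot (cA c) (cA k) = rc (nsq (c + k) - nsq c - nsq k).
Proof. by rewrite !rmorphB -!hnorm_cA rmorphD hnormD; ring. Qed.

Lemma hdotMr a b g : hdot (a * g) (b * g) = hdot a b * hnorm g.
Proof. by rewrite /hdot /hnorm !rmorphM /=; ring. Qed.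

Lemma hdotBl f g k : hdot (f - g) k = hdot f k - hdot g k.
Proof. by rewrite /hdot !rmorphB /=; ring. Qed.

Definition bounded h g := exists c, M (rc c * hnorm g - hnorm h).
Definition negligible h g := forall e, 0 < e -> M (rc e * hnorm g - hnorm h).

Lemma negligible_bounded h g : negligible h g -> bounded h g.
Proof. by move=> s; exists 1; apply: s. Qed.

Lemma std_hdot_exists h g k : g != 0 -> hnorm k = hnorm g -> bounded h g ->
  exists q, std (hnorm g) (hdot h k) q.
Proof.
move=> g0 kg [c Mc]; have su := sos_hnorm g; have u0 := hnorm_neq0 g0.
apply: (@std_exists _ _ (c + 1)) => //; first exact: hdot_selfadj.
  have -> : rc (c + 1) * hnorm g - hdot h k = (rc c * hnorm g - hnorm h) + hnorm (h - k).
    by rewrite hnormB kg; ring.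
  by apply: MD => //; apply/Msos/sos_hnorm.
have -> : rc (c + 1) * hnorm g + hdot h k = (rc c * hnorm g - hnorm h) + hnorm (h + k).
  by rewrite hnormD kg; ring.
by apply: MD => //; apply/Msos/sos_hnorm.
Qed.

Lemma hnormD_bound f g : hnorm (f + g) = rc 2 * hnorm f + rc 2 * hnorm g - hnorm (f - g).
Proof. by rewrite hnormD hnormB; ring. Qed.

Lemma hnormB_bound f g : hnorm (f - g) = rc 2 * hnorm f + rc 2 * hnorm g - hnorm (f + g).
Proof. by rewrite hnormB hnormD; ring. Qed.

Lemma boundedB h k g : bounded h g -> bounded k g -> bounded (h - k) g.
Proof.
move=> [c Mc] [b Mb]; exists (2 * c + 2 * b); rewrite hnormB_bound.
have -> : rc (2 * c + 2 * b) * hnorm g - (rc 2 * hnorm h + rc 2 * hnorm k - hnorm (h + k)) =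
  rc 2 * (rc c * hnorm g - hnorm h) + rc 2 * (rc b * hnorm g - hnorm k) + hnorm (h + k) by ring.
apply: MD; last exact/Msos/sos_hnorm.
by apply: MD; apply: cone_rcM.
Qed.

Lemma bounded_cA c g : bounded (cA c * g) g.
Proof.
by exists (nsq c); rewrite hnormM hnorm_cA subrr; apply/Msos/sos0.
Qed.

(* If [h / g] is centred, that is [hdot h g] and [hdot h (i g)] have standard
   part [0], then the standard part [m] of [|h / g|^2] satisfies
   [2 m^2 + 2 = 2 (m + 1)^2] by the parallelogram law for [h^2] and [g^2]. *)
Lemma residue_exists h g : g != 0 -> bounded h g -> exists c, negligible (h - cA c * g) g.
Proof.
move=> g0 bh; set u := hnorm g; have su : sos u := sos_hnorm g; have u0 : u != 0 := hnorm_neq0 g0.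
pose ii : R[i] := Complex 0 1.
have Nii : hnorm (cA ii) = 1 by rewrite hnorm_cA /nsq /= expr0n expr1n add0r rmorph1.
have Nig : hnorm (cA ii * g) = u by rewrite hnormM Nii mul1r.
have [a sa] := std_hdot_exists g0 (erefl _) bh.
have [b sb] := std_hdot_exists g0 Nig bh.
(* Relative to [u], [hdot h g] and [hdot h (i g)] stand for [2 Re (h / g)] and [2 Im (h / g)];
   subtracting [c * g] centres [h / g]. *)
pose c : R[i] := Complex (a / 2) (b / 2); exists c; set k := h - cA c * g.
have bk : bounded k g by apply: boundedB => //; apply: bounded_cA.
have s1 : std u (hdot k g) 0.
  have -> : hdot k g = hdot h g - hdot (cA c) (cA 1) * u by rewrite hdotBl -hdotMr rmorph1 mul1r.
  rewrite hdot_cA -(subrr a).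
  apply: (stdD sa); apply: stdN; have -> : nsq (c + 1) - nsq c - nsq 1 = a.
    by rewrite /nsq /=; field.
  exact: std_rc.
have s2 : std u (hdot k (cA ii * g)) 0.
  rewrite hdotBl hdotMr hdot_cA -/u -(subrr b).
  apply: (stdD sb); apply: stdN; have -> : nsq (c + ii) - nsq c - nsq ii = b.
    by rewrite /nsq /=; field.
  exact: std_rc.
have [m sm] : exists m, std u (hnorm k) m.
  have [d Md] := bk; apply: (@std_exists _ _ (Num.max d 0)) => //; first exact: hnorm_selfadj.
    have -> : rc (Num.max d 0) * u - hnorm k = (rc d * u - hnorm k) + rc (Num.max d 0 - d) * u by ring.
    by apply: MD => //; apply: cone_rcM; [rewrite subr_ge0 le_max lexx|exact: Msos].
  apply: MD; last exact/Msos/sos_hnorm.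
  by apply: cone_rcM; [rewrite le_max lexx orbT|exact: Msos].
have m0 : 0 <= m by apply: (std_ge0 su u0 sm); apply/Msos/sos_hnorm.
have su1 : std u u 1 by rewrite -{2}(mul1r u) -(rmorph1 rc); apply: std_rc.
have q1 : std u (hnorm (k - g)) (m + 1).
  by rewrite hnormB -[m + 1]subr0; apply: stdD; [exact: stdD|exact: stdN].
have q2 : std u (hnorm (k + g)) (m + 1).
  by rewrite hnormD -[m + 1]addr0; apply: stdD => //; exact: stdD.
have q3 : std u (hnorm (k - cA ii * g)) (m + 1).
  by rewrite hnormB Nig -[m + 1]subr0; apply: stdD; [exact: stdD|exact: stdN].
have q4 : std u (hnorm (k + cA ii * g)) (m + 1).
  by rewrite hnormD Nig -[m + 1]addr0; apply: stdD => //; exact: stdD.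
have m10 : 0 <= m + 1 by rewrite addr_ge0.
have P12 := stdM su (sos_hnorm _) su (sos_hnorm _) m10 m10 q1 q2.
have P34 := stdM su (sos_hnorm _) su (sos_hnorm _) m10 m10 q3 q4.
have Pk := stdM su (sos_hnorm _) su (sos_hnorm _) m0 m0 sm sm.
have Pu := stdM su su su su ler01 ler01 su1 su1.
have E1 : hnorm (k - g) * hnorm (k + g) + hnorm (k - cA ii * g) * hnorm (k + cA ii * g) =
    (hnorm k * hnorm k + hnorm k * hnorm k) + (u * u + u * u).
  have ii2 : cA ii * cA ii = -1.
    by rewrite -rmorphM -(rmorph1 cA) -rmorphN; congr (cA _); apply/eqP; rewrite eq_complex /=; apply/andP; split; apply/eqP; ring.
  rewrite -!hnormM.
  have -> : (k - g) * (k + g) = k * k - g * g by ring.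
  have -> : (k - cA ii * g) * (k + cA ii * g) = k * k - (cA ii * cA ii) * (g * g) by ring.
  by rewrite ii2 mulN1r opprK hnormB hnormD !hnormM -/u; ring.
have S1 := stdD P12 P34; rewrite E1 in S1.
have S2 := stdD (stdD Pk Pk) (stdD Pu Pu).
have suu : sos (u * u) by apply: sosM.
have uu0 : u * u != 0 by rewrite mulf_neq0.
have me : m = 0 by have := std_unique suu uu0 S1 S2; nra.
by move=> e e0; have [+ _] := sm e e0; rewrite me add0r.
Qed.

Lemma negligible_equiv h g h' g' : g != 0 -> h * g' = h' * g ->
  negligible h g -> negligible h' g'.
Proof.
move=> g0 E s e e0; apply: (@maximal_cone_saturated (hnorm g)).
- exact: sos_hnorm.
- exact: hnorm_neq0.
- by apply: selfadjB; [apply: selfadj_rcM|]; apply: hnorm_selfadj.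
have -> : hnorm g * (rc e * hnorm g' - hnorm h') = hnorm g' * (rc e * hnorm g - hnorm h).
  rewrite !mulrBr; congr (_ - _); first by ring.
  by rewrite -!hnormM mulrC -E; congr hnorm; rewrite mulrC.
by apply: MsosM; [exact: sos_hnorm|exact: s].
Qed.

Lemma negligibleD h k g : negligible h g -> negligible k g -> negligible (h + k) g.
Proof.
move=> sh sk e e0; have e4 : 0 < e / 4 by rewrite divr_gt0.
rewrite hnormD_bound; have -> : rc e * hnorm g - (rc 2 * hnorm h + rc 2 * hnorm k - hnorm (h - k)) =
    rc 2 * (rc (e / 4) * hnorm g - hnorm h) + rc 2 * (rc (e / 4) * hnorm g - hnorm k) + hnorm (h - k).
  have {1}-> : e = 2 * (e / 4) + 2 * (e / 4) by field.
  by ring.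
apply: MD; last exact/Msos/sos_hnorm.
by apply: MD; apply: cone_rcM => //; [exact: sh|exact: sk].
Qed.

Lemma negligibleM h g h' g' : negligible h g -> bounded h' g' -> negligible (h * h') (g * g').
Proof.
move=> sh [c Mc] e e0; pose b := Num.max c 1.
have b0 : 0 < b by rewrite lt_max ltr01 orbT.
have Mb : M (rc b * hnorm g' - hnorm h').
  have -> : rc b * hnorm g' - hnorm h' = (rc c * hnorm g' - hnorm h') + rc (b - c) * hnorm g' by ring.
  by apply: MD => //; apply: cone_rcM; [rewrite subr_ge0 le_max lexx|exact/Msos/sos_hnorm].
have -> : rc e * hnorm (g * g') - hnorm (h * h') =
    hnorm h' * (rc (e / b) * hnorm g - hnorm h) +
    rc (e / b) * (hnorm g * (rc b * hnorm g' - hnorm h')).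
  have {1}-> : e = e / b * b by rewrite divfK // gt_eqF.
  by rewrite !hnormM; ring.
apply: MD; first by apply: MsosM; [exact: sos_hnorm|apply: sh; rewrite divr_gt0].
apply: cone_rcM; first by rewrite divr_ge0 // ltW.
by apply: MsosM => //; exact: sos_hnorm.
Qed.

Lemma negligible_cA c g : g != 0 -> negligible (cA c * g) g -> c = 0.
Proof.
move=> g0 sc; apply/eqP; rewrite -[_ == 0]negbK; apply/negP => c0.
have n0 := nsq_gt0 c0; have := sc (nsq c / 2) (divr_gt0 n0 (ltr0n _ 2)).
rewrite hnormM hnorm_cA -mulrBl -rmorphB => /(cone_rc_ge0 (sos_hnorm g) (hnorm_neq0 g0)).
by move: n0; set q := nsq c; lra.
Qed.

(** Let [c != 0] be the residue of [g / h] and [q = |c|^2]. Then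
    [q |h|^2 <= 2 |g|^2 + 2 |g - c h|^2], and the last norm is at most [(q / 4) |h|^2]; this leaves
    [|h|^2 <= (4 / q) |g|^2]. *)
Lemma bounded_total h g : h != 0 -> bounded h g \/
  exists c, negligible (g - cA c * h) h /\ (c != 0 -> bounded h g).
Proof.
move=> h0; have hh : selfadj (hnorm g - hnorm h) by apply: selfadjB; apply: hnorm_selfadj.
have [Mg|Mh] := maximal_cone_total hh.
  by left; exists 1; rewrite rmorph1 mul1r.
have bg : bounded g h by exists 1; rewrite rmorph1 mul1r -opprB.
have [c sc] := residue_exists h0 bg; right; exists c; split=> // c0.
have n0 := nsq_gt0 c0; set q := nsq c in n0.
exists (4 / q); have := sc (q / 4) (divr_gt0 n0 (ltr0n _ 4)) => Ms.
have T : hnorm (g + (g - cA c * h)) =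
    rc 2 * hnorm g + rc 2 * hnorm (g - cA c * h) - rc q * hnorm h.
  by rewrite hnormD_bound -(hnorm_cA c) -hnormM; congr (_ - hnorm _); ring.
have -> : rc (4 / q) * hnorm g - hnorm h = rc (4 / q) *
    ((rc (q / 4) * hnorm h - hnorm (g - cA c * h)) + rc 2^-1 * hnorm (g + (g - cA c * h))).
  have rc1 x : x = 1 -> rc x = 1 by move=> ->; rewrite rmorph1.
  have e1 : rc (4 / q) * rc (q / 4) = 1.
    by rewrite -rmorphM; apply: rc1; field; rewrite gt_eqF.
  have e2 : rc 2^-1 * rc 2 = 1 by rewrite -rmorphM; apply: rc1; field.
  have e3 : rc (4 / q) * (rc 2^-1 * rc q) = 1 + 1.
    rewrite -!rmorphM (_ : 4 / q * (2^-1 * q) = 1 + 1) ?rmorphD ?rmorph1 //.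
    by field; rewrite gt_eqF.
  rewrite T; move: (hnorm g) (hnorm h) (hnorm (g - _)) => X W Y.
  transitivity (rc (4 / q) * rc (q / 4) * W - rc (4 / q) * Y +
    rc (4 / q) * ((rc 2^-1 * rc 2) * X + (rc 2^-1 * rc 2) * Y) -
    rc (4 / q) * (rc 2^-1 * rc q) * W); first by rewrite e1 e2 e3; ring.
  by ring.
apply: cone_rcM; first by rewrite divr_ge0 // ltW.
by apply: MD => //; apply: cone_rcM; [rewrite invr_ge0|exact/Msos/sos_hnorm].
Qed.

Lemma std_negligible h g c : g != 0 -> negligible (h - cA c * g) g ->
  std (hnorm g) (hnorm h) (nsq c).
Proof.
move=> g0 sd; set d := h - cA c * g in sd; set u := hnorm g.
have su : sos u := sos_hnorm g; have u0 : u != 0 := hnorm_neq0 g0.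
have s0 : std u (hnorm d) 0.
  move=> e e0; rewrite add0r sub0r rmorphN mulNr opprK; split; first exact: sd.
  apply: MD; first exact/Msos/sos_hnorm.
  by apply: cone_rcM; [exact: ltW|exact: Msos].
have hE : h = d + cA c * g by rewrite /d subrK.
clearbody d.
have bd : bounded d g by apply: negligible_bounded.
have [a sa] := std_hdot_exists g0 (erefl _) bd.
have sq : std u (hnorm (cA c * g)) (nsq c) by rewrite hnormM hnorm_cA; apply: std_rc.
suff sc : std u (hdot d (cA c * g)) 0.
  by rewrite hE hnormD -[nsq c]addr0 -[nsq c]add0r; apply: stdD => //; apply: stdD.
have bb : exists b, std u (hdot d (cA c * g)) b.
  have [k Mk] := bd; apply: (@std_exists _ _ (k + nsq c)) => //; first exact: hdot_selfadj.
    have -> : rc (k + nsq c) * u - hdot d (cA c * g) =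
        (rc k * u - hnorm d) + hnorm (d - cA c * g) by rewrite hnormB (hnormM (cA c)) hnorm_cA -/u; ring.
    by apply: MD => //; apply/Msos/sos_hnorm.
  have -> : rc (k + nsq c) * u + hdot d (cA c * g) =
      (rc k * u - hnorm d) + hnorm (d + cA c * g) by rewrite hnormD (hnormM (cA c)) hnorm_cA -/u; ring.
  by apply: MD => //; apply/Msos/sos_hnorm.
have [b sb] := bb; suff b0 : b = 0 by rewrite b0 in sb.
(* [|t c g - d|^2 >= 0] for every real [t] *)
have tb t : 0 <= t ^+ 2 * nsq c - t * b.
  have Nt : hnorm (cA t%:C%C) = rc (t ^+ 2) by rewrite hnorm_cA /nsq /= expr0n addr0.
  have St : std u (hnorm (d - cA t%:C%C * (cA c * g))) (0 + t ^+ 2 * nsq c - t * b).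
    rewrite hnormB [hnorm (cA t%:C%C * _)]hnormM Nt.
    have -> : hdot d (cA t%:C%C * (cA c * g)) = rc t * hdot d (cA c * g).
      have [h1 h2] := hol_real t.
      by rewrite /hdot !(rmorphM hol, rmorphM star) /= h2 h1; ring.
    apply: stdD; first by apply: stdD => //; apply: std_rcM.
    by apply: stdN; apply: std_rcM.
  by have := std_ge0 su u0 St (Msos (sos_hnorm _)); rewrite add0r.
(* For [t = b / (nsq c + 1)] the expression in [tb] equals [- t ^+ 2], also when [c = 0]. *)
have k0 : 0 < nsq c + 1 by rewrite ltr_wpDl // /nsq addr_ge0 // sqr_ge0.
have := tb (b / (nsq c + 1)).
have -> : (b / (nsq c + 1)) ^+ 2 * nsq c - b / (nsq c + 1) * b = - (b / (nsq c + 1)) ^+ 2.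
  by field; rewrite gt_eqF.
rewrite oppr_ge0 => bneg; have /eqP := le_anti (introT andP (conj bneg (sqr_ge0 _))).
by rewrite sqrf_eq0 mulf_eq0 invr_eq0 (gt_eqF k0) orbF => /eqP.
Qed.



Local Notation tofrac := (@FracField.tofrac A).
Definition frac_iota : {rmorphism R[i] -> {fraction A}} := tofrac \o cA.

Definition frac_negligible x := exists h g, [/\ g != 0, x = tofrac h / tofrac g & negligible h g].
Definition frac_bounded x := exists h g, [/\ g != 0, x = tofrac h / tofrac g & bounded h g].

Lemma frac_eq h g h' g' : g != 0 -> g' != 0 ->
  tofrac h / tofrac g = tofrac h' / tofrac g' -> h * g' = h' * g.
Proof.
move=> g0 g'0 /eqP; rewrite eqr_div ?tofrac_eq0 // -!rmorphM tofrac_eq => /eqP.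
by move=> ->.
Qed.

Lemma frac_negligibleP h g : g != 0 -> frac_negligible (tofrac h / tofrac g) -> negligible h g.
Proof.
move=> g0 [h' [g' [g'0 E]]]; apply: negligible_equiv => //.
exact: frac_eq (esym E).
Qed.

Lemma frac_negligibleD x y : frac_negligible x -> frac_negligible y -> frac_negligible (x + y).
Proof.
move=> [h [g [g0 -> s]]] [h' [g' [g'0 -> s']]].
exists (h * g' + h' * g), (g * g'); split; first exact: mulf_neq0.
  by rewrite addf_div ?tofrac_eq0 // rmorphD !rmorphM /=.
apply: negligibleD; first by apply: (negligible_equiv g0) s; ring.
by apply: (negligible_equiv g'0) s'; ring.
Qed.

Lemma frac_negligibleM x y : frac_negligible x -> frac_bounded y -> frac_negligible (x * y).
Proof.
move=> [h [g [g0 -> s]]] [h' [g' [g'0 -> s']]].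
exists (h * h'), (g * g'); split; first exact: mulf_neq0.
  by rewrite mulf_div !rmorphM.
exact: negligibleM.
Qed.

Lemma frac_iota_sub c h g : g != 0 ->
  tofrac h / tofrac g - frac_iota c = tofrac (h - cA c * g) / tofrac g.
Proof. by move=> g0; rewrite rmorphB rmorphM mulrBl mulfK ?tofrac_eq0. Qed.

Lemma frac_iota_bounded c : frac_bounded (frac_iota c).
Proof.
exists (cA c), 1; split; rewrite ?oner_eq0 //; first by rewrite rmorph1 divr1.
by rewrite -[cA c]mulr1; apply: bounded_cA.
Qed.

Lemma frac_iota_negligible c : frac_negligible (frac_iota c) -> c = 0.
Proof.
have -> : frac_iota c = tofrac (cA c * 1) / tofrac 1 by rewrite mulr1 rmorph1 divr1.
move/(frac_negligibleP (oner_neq0 A)).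
by apply: negligible_cA; apply: oner_neq0.
Qed.

Definition frac_val x := exists c, frac_negligible (x - frac_iota c).
Definition frac_res x : R[i] :=
  if pselect (frac_val x) is left H then projT1 (cid H) else 0.

Lemma frac_res_negligible x : frac_val x -> frac_negligible (x - frac_iota (frac_res x)).
Proof.
move=> Vx; rewrite /frac_res; case: pselect => // H.
by case: (cid H).
Qed.

Lemma frac_negligibleN x : frac_negligible x -> frac_negligible (- x).
Proof.
move=> nx; rewrite -mulrN1; apply: frac_negligibleM => //.
by rewrite -(rmorph1 frac_iota) -rmorphN; apply: frac_iota_bounded.
Qed.

Lemma frac_res_unique x c : frac_negligible (x - frac_iota c) -> frac_res x = c.
Proof.
move=> nx; have nr := frac_res_negligible (ex_intro _ c nx).
apply/eqP; rewrite -subr_eq0; apply/eqP/frac_iota_negligible; rewrite rmorphB.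
have -> : frac_iota (frac_res x) - frac_iota c =
  (x - frac_iota c) + - (x - frac_iota (frac_res x)) by ring.
by apply: frac_negligibleD => //; apply: frac_negligibleN.
Qed.

Lemma frac_val_bounded x : frac_val x -> frac_bounded x.
Proof.
move=> [c]; have [h [g [g0 ->]]] := fraction_repr x.
rewrite frac_iota_sub // => /(frac_negligibleP g0) s; exists h, g; split=> //.
have -> : h = (h - cA c * g) - cA (- c) * g by rewrite rmorphN; ring.
by apply: boundedB; [exact: negligible_bounded|exact: bounded_cA].
Qed.

Lemma frac_negligible0 : frac_negligible 0.
Proof.
exists 0, 1; split; rewrite ?oner_eq0 ?rmorph0 ?mul0r //.
move=> e e0; rewrite /hnorm !rmorph0 !mul0r subr0 !rmorph1 !mulr1.
by apply/Msos/sos_rc/ltW.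
Qed.

Lemma frac_val_iota c : frac_val (frac_iota c).
Proof. by exists c; rewrite subrr; apply: frac_negligible0. Qed.

Lemma frac_addE x y c b : frac_negligible (x - frac_iota c) -> frac_negligible (y - frac_iota b) ->
  frac_negligible (x + y - frac_iota (c + b)).
Proof.
move=> nx ny; have -> : x + y - frac_iota (c + b) = (x - frac_iota c) + (y - frac_iota b).
  by rewrite rmorphD; ring.
exact: frac_negligibleD.
Qed.

Lemma frac_mulE x y c b : frac_negligible (x - frac_iota c) -> frac_negligible (y - frac_iota b) ->
  frac_negligible (x * y - frac_iota (c * b)).
Proof.
move=> nx ny; have -> : x * y - frac_iota (c * b) =
    (x - frac_iota c) * y + (y - frac_iota b) * frac_iota c by rewrite rmorphM; ring.
apply: frac_negligibleD; apply: frac_negligibleM => //; last exact: frac_iota_bounded.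
by apply: frac_val_bounded; exists b.
Qed.

Lemma frac_val_total x : frac_val x \/ (frac_val x^-1 /\ frac_res x^-1 = 0).
Proof.
have [h [g [g0 xE]]] := fraction_repr x.
have [bh|nb] := pselect (bounded h g).
  left; have [c s] := residue_exists g0 bh; exists c.
  by rewrite xE frac_iota_sub //; exists (h - cA c * g), g.
have h0 : h != 0.
  apply/eqP => h0; apply: nb; rewrite h0 -(mul0r g) -(rmorph0 cA); exact: bounded_cA.
have [//|[c [s cb]]] := bounded_total g h0.
have nx : frac_negligible (x^-1 - frac_iota c).
  by rewrite xE invf_div frac_iota_sub //; exists (g - cA c * h), h.
right; split; first by exists c.
rewrite (frac_res_unique nx); apply/eqP; rewrite -[_ == 0]negbK; apply/negP => c0.
by apply: nb; apply: cb.
Qed.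

Lemma frac_valD x y : frac_val x -> frac_val y -> frac_val (x + y).
Proof. by move=> [c nx] [b ny]; exists (c + b); apply: frac_addE. Qed.

Lemma frac_valM x y : frac_val x -> frac_val y -> frac_val (x * y).
Proof. by move=> [c nx] [b ny]; exists (c * b); apply: frac_mulE. Qed.

Lemma frac_resD x y : frac_val x -> frac_val y -> frac_res (x + y) = frac_res x + frac_res y.
Proof. by move=> vx vy; apply: frac_res_unique; apply: frac_addE; apply: frac_res_negligible. Qed.

Lemma frac_resM x y : frac_val x -> frac_val y -> frac_res (x * y) = frac_res x * frac_res y.
Proof. by move=> vx vy; apply: frac_res_unique; apply: frac_mulE; apply: frac_res_negligible. Qed.

Lemma frac_res_iota c : frac_res (frac_iota c) = c.
Proof. by apply: frac_res_unique; rewrite subrr; apply: frac_negligible0. Qed.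

Definition cone_place : place frac_iota :=
  Place frac_val_iota frac_valD frac_valM frac_res_iota frac_resD frac_resM frac_val_total.

Lemma cone_place_std h g : g != 0 -> val_ring cone_place (tofrac h / tofrac g) ->
  std (hnorm g) (hnorm h) (nsq (residue cone_place (tofrac h / tofrac g))).
Proof.
move=> g0 vh; apply: std_negligible => //; apply: frac_negligibleP => //.
by rewrite -frac_iota_sub //; apply: frac_res_negligible.
Qed.

Lemma cone_place_form r I (d : 'I_I -> R) (h : 'I_I -> A) g :
    r = \sum_i rc (d i) * hnorm (h i) -> M (- r) -> g != 0 ->
    (forall i, val_ring cone_place (tofrac (h i) / tofrac g)) ->
  \sum_i d i * nsq (residue cone_place (tofrac (h i) / tofrac g)) <= 0.
Proof.
move=> rE Mr g0 vh; rewrite -oppr_ge0.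
have u0 := hnorm_neq0 g0; have su := sos_hnorm g.
apply: (std_ge0 su u0 _ Mr); apply: stdN; rewrite rE.
elim: (index_enum _) => [|i s IH].
  by rewrite !big_nil -(mul0r (hnorm g)) -(rmorph0 rc); apply: std_rc.
by rewrite !big_cons; apply: stdD => //; apply: std_rcM; apply: cone_place_std.
Qed.

End MaximalCone.

Lemma nonquotient_place r I (d : 'I_I -> R) (h : 'I_I -> A) : selfadj r ->
    ~ (exists g, [/\ sos g, g != 0 & sos (r * g)]) ->
    r = \sum_i rc (d i) * hnorm (h i) ->
  exists P : place frac_iota, forall g, g != 0 ->
    (forall i, val_ring P (FracField.tofrac (h i) / FracField.tofrac g)) ->
    \sum_i d i * nsq (residue P (FracField.tofrac (h i) / FracField.tofrac g)) <= 0.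
Proof.
move=> hr nr rE; have [M [cM Mr Mmax]] := nonquotient_cone hr nr.
by exists (cone_place cM Mmax) => g g0 vh; exact: (cone_place_form rE Mr g0 vh).
Qed.

End HermitianCones.

(** * Hermitian polynomials *)

Lemma split_lshift m k (i : 'I_m) : split (lshift k i) = inl i.
Proof. by rewrite -[lshift k i]/(unsplit (inl i)) unsplitK. Qed.

Lemma split_rshift m k (i : 'I_k) : split (rshift m i) = inr i.
Proof. by rewrite -[rshift m i]/(unsplit (inr i)) unsplitK. Qed.

(* Morphisms given by [mmap] are sealed: unfolding them makes unification diverge. *)
Lemma opaque_rmorphism (S T : nzRingType) (phi : {rmorphism S -> T}) :
  {psi : {rmorphism S -> T} | psi =1 phi}.
Proof. by exists phi. Qed.

Section Hermitian.
Variables (R : realType) (n : nat).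
Local Notation C := R[i].
Local Notation A := {mpoly C[n]}.
Local Notation Z := {mpoly C[n + n]}.

Definition hol : {rmorphism A -> Z} :=
  sval (opaque_rmorphism (mmap (@mpolyC (n + n) C) (fun i => 'X_(lshift n i)))).
Definition star : {rmorphism Z -> Z} :=
  sval (opaque_rmorphism (mmap (@mpolyC (n + n) C \o Num.conj) (fun i => 'X_(swap_ord i)))).
Definition constA : {rmorphism C -> A} := sval (opaque_rmorphism (@mpolyC n C)).
Definition constZ : {rmorphism C -> Z} := sval (opaque_rmorphism (@mpolyC (n + n) C)).
Definition real_const : {rmorphism R -> Z} :=
  sval (opaque_rmorphism (constZ \o real_complex R)).

Lemma holE f : hol f = mmap (@mpolyC (n + n) C) (fun i => 'X_(lshift n i)) f.
Proof. exact: svalP (opaque_rmorphism _) f. Qed.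

Lemma starE p : star p = mmap (@mpolyC (n + n) C \o Num.conj) (fun i => 'X_(swap_ord i)) p.
Proof. exact: svalP (opaque_rmorphism _) p. Qed.

Lemma constAE c : constA c = c%:MP.
Proof. exact: svalP (opaque_rmorphism _) c. Qed.

Lemma constZE c : constZ c = c%:MP.
Proof. exact: svalP (opaque_rmorphism _) c. Qed.

Lemma real_constE c : real_const c = constZ c%:C%C.
Proof. exact: svalP (opaque_rmorphism _) c. Qed.

Lemma swap_ordK : involutive (@swap_ord n).
Proof.
move=> i; rewrite {2}/swap_ord; case: (splitP i) => j ij; rewrite /swap_ord.
  case: (splitP (rshift n j)) => k /= E; last by apply: val_inj; rewrite /= ij (addnI E).
  by have := ltn_ord k; rewrite -E ltnNge leq_addr.
case: (splitP (lshift n j)) => k /= E; first by apply: val_inj; rewrite /= ij -E.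
by have := ltn_ord j; rewrite E ltnNge leq_addr.
Qed.

Lemma hol_constA c : hol (constA c) = constZ c.
Proof. by rewrite holE constAE constZE mmapC. Qed.

Lemma holX i : hol 'X_i = 'X_(lshift n i).
Proof. by rewrite holE mmapX mmap1U. Qed.

Lemma star_constZ c : star (constZ c) = constZ c^*.
Proof. by rewrite starE !constZE mmapC. Qed.

Lemma starX i : star 'X_i = 'X_(swap_ord i).
Proof. by rewrite starE mmapX mmap1U. Qed.

Lemma starK : involutive star.
Proof.
move=> p; rewrite [in LHS](starE p) rmorph_mmap -[RHS]comp_mpoly_id.
apply: eq_mmap => [c|i]; last by rewrite tnth_mktuple [LHS]starX swap_ordK.
by rewrite -[LHS]/(star c^*%:MP) -constZE star_constZ constZE conjCK.
Qed.

Lemma star_real_const c : star (real_const c) = real_const c.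
Proof. by rewrite real_constE star_constZ conj_real. Qed.

Lemma hnorm_constA c : hnorm hol star (constA c) = real_const (nsq c).
Proof. by rewrite /hnorm hol_constA star_constZ -rmorphM mulrC -nsqE real_constE. Qed.

Lemma hol_real c :
  hol (constA c%:C%C) = real_const c /\ star (hol (constA c%:C%C)) = real_const c.
Proof. by rewrite hol_constA star_constZ conj_real real_constE. Qed.

Lemma swap_mnmK : involutive (@swap_mnm n).
Proof. by move=> m; apply/mnmP => i; rewrite !mnmE swap_ordK. Qed.

Lemma swap_ord_bij : bijective (@swap_ord n).
Proof. by exists (@swap_ord n); apply: swap_ordK. Qed.

Lemma coef_star p m : (star p)@_m = (p@_(swap_mnm m))^*.
Proof.
have H (m' : 'X_{1..n + n}) : mmap1 (fun i => 'X_(swap_ord i) : Z) m' = 'X_[swap_mnm m'].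
  rewrite mpolyXE_id /mmap1 (reindex (@swap_ord n)) /=; last exact/onW_bij/swap_ord_bij.
  by apply: eq_bigr => i _; rewrite swap_ordK mnmE.
rewrite starE /mmap.
under eq_bigr => m' _ do rewrite H /=.
rewrite [in RHS](mpolyE p) !raddf_sum /=; apply: eq_bigr => m' _.
rewrite mul_mpolyC !mcoeffZ !mcoeffX rmorphM /= rmorph_nat; congr (_ * (_)%:R).
by congr nat_of_bool; apply/eqP/eqP => [<-|->]; rewrite swap_mnmK.
Qed.

Lemma hermitian_symmetricP r : hermitian_symmetric r <-> selfadj star r.
Proof.
rewrite /hermitian_symmetric /selfadj; split=> [H|H m].
  by apply/mpolyP => m; rewrite coef_star -H.
by rewrite -{1}H coef_star.
Qed.

Lemma diag_pt_swap (z : 'I_n -> C) i : diag_pt z (swap_ord i) = (diag_pt z i)^*.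
Proof.
rewrite /diag_pt /swap_ord; case: (split i) => j.
  by rewrite split_rshift.
by rewrite split_lshift conjCK.
Qed.

Lemma heval_hol f z : heval (hol f) z = f.@[z].
Proof.
rewrite /heval holE rmorph_mmap; apply: eq_mmap => [c|i] /=; first by rewrite mevalC.
by rewrite mevalXU /diag_pt split_lshift.
Qed.

Lemma heval_star p z : heval (star p) z = (heval p z)^*.
Proof.
rewrite /heval starE rmorph_mmap [in RHS]/meval rmorph_mmap.
apply: eq_mmap => [c|i] /=; first by rewrite mevalC.
by rewrite mevalXU diag_pt_swap.
Qed.

Lemma hevalM (p q : Z) (z : 'I_n -> C) : heval (p * q) z = heval p z * heval q z.
Proof. exact: mevalM. Qed.

Lemma heval_big I (r : seq I) (G : I -> Z) z :
  heval (\sum_(i <- r) G i) z = \sum_(i <- r) heval (G i) z.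
Proof. exact: (rmorph_sum (meval (diag_pt z))). Qed.

Lemma heval_real_const c z : heval (real_const c) z = c%:C%C.
Proof. by rewrite real_constE constZE /heval mevalC. Qed.

Lemma heval_hnorm f z : heval (hnorm hol star f) z = `|f.@[z]| ^+ 2.
Proof. by rewrite /hnorm hevalM heval_star heval_hol -normCK. Qed.

Lemma heval_sum (F : seq A) z : heval (\sum_(f <- F) hnorm hol star f) z = sqnorm F z.
Proof.
by rewrite heval_big; apply: eq_bigr => f _; apply: heval_hnorm.
Qed.

(* The diagonal [w = z] is totally real of maximal dimension. *)
Lemma heval_eq0 (p : Z) : (forall z, heval p z = 0) -> p = 0.
Proof.
(* The substitution [z = x + i y], [wbar = x - i y] sends natural [x], [y] to points of the
   diagonal, so it turns [p] into a polynomial vanishing at all natural points; [v] below inverts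
   it. *)
move=> pz; pose ii : C := 'i.
pose L (j : 'I_(n + n)) : Z := match split j with
  | inl k => 'X_(lshift n k) + ii *: 'X_(rshift n k)
  | inr k => 'X_(lshift n k) - ii *: 'X_(rshift n k) end.
pose q : Z := mmap (@mpolyC (n + n) C) L p.
have qE v : q.@[v] = p.@[fun j => (L j).@[v]].
  by rewrite {2}/meval /q rmorph_mmap; apply: eq_mmap => c //=; rewrite mevalC.
have q0 : q = 0.
  apply: mpoly_nat_eq0 => v; rewrite qE.
  rewrite -[RHS](pz (fun k => (v (lshift n k))%:R + ii * (v (rshift n k))%:R)) /heval.
  apply: meval_eq => j; rewrite /L /diag_pt; case: (split j) => k.
    by rewrite mevalD mevalZ !mevalXU.
  by rewrite mevalB mevalZ !mevalXU rmorphD rmorphM /= !conjC_nat conjCi mulNr.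
apply: mpoly_eval_eq0 => w.
pose v (j : 'I_(n + n)) : C := match split j with
  | inl k => (w (lshift n k) + w (rshift n k)) / 2
  | inr k => (w (lshift n k) - w (rshift n k)) / (2 * ii) end.
have := qE v; rewrite q0 meval0 => /esym E; rewrite -[RHS]E; apply: meval_eq => j.
have ii0 : ii != 0 by apply: neq0Ci.
rewrite /L; case: (splitP j) => k jk.
  have -> : j = lshift n k by apply: val_inj.
  by rewrite mevalD mevalZ !mevalXU /v split_lshift split_rshift; field.
have -> : j = rshift n k by apply: val_inj.
by rewrite mevalB mevalZ !mevalXU /v split_lshift split_rshift; field.
Qed.

Lemma heval_inj (p q : Z) : (forall z, heval p z = heval q z) -> p = q.
Proof.
move=> pq; apply/eqP; rewrite -subr_eq0; apply/eqP/heval_eq0 => z.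
by rewrite /heval mevalB -!/(heval _ _) pq subrr.
Qed.

Lemma hnorm_sum_eq0 (s : seq A) : \sum_(f <- s) hnorm hol star f = 0 ->
  forall f, f \in s -> f = 0.
Proof.
move=> s0 f fs; apply: mpoly_eval_eq0 => z.
have := congr1 (fun p => heval p z) s0; rewrite /= heval_sum /heval meval0 /sqnorm.
move/eqP; rewrite psumr_eq0 => [/allP /(_ f fs)|g _]; last exact: exprn_ge0.
by rewrite sqrf_eq0 normr_eq0 => /eqP.
Qed.

End Hermitian.

(** * Diagonal Hermitian forms with independent entries *)

Lemma sum_split (V : nmodType) I J (a : 'I_I -> V) (b : 'I_J -> V) :
  \sum_(i < I + J) (match split i with inl j => a j | inr j => b j end) =
  \sum_i a i + \sum_j b j.
Proof.
rewrite big_split_ord; congr (_ + _); apply: eq_bigr => i _.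
  by rewrite split_lshift.
by rewrite split_rshift.
Qed.

Section HermitianForms.
Variables (R : rcfType) (A Z : idomainType).
Variables (cA : {rmorphism R[i] -> A}) (cZ : {rmorphism R[i] -> Z}) (rc : {rmorphism R -> Z}).
Variables (hol : {rmorphism A -> Z}) (star : {rmorphism Z -> Z}).
Hypothesis starK : involutive star.
Hypothesis rcE : forall c, rc c = cZ c%:C%C.
Hypothesis hol_cA : forall c, hol (cA c) = cZ c.
Hypothesis star_cZ : forall c, star (cZ c) = cZ c^*.
Local Notation nrm := (hnorm hol star).

Lemma polarize (ev : {rmorphism Z -> A}) (e : A -> R[i]) I J L (d : 'I_I -> R) (h : 'I_I -> A)
    (d' : 'I_J -> R) (h' : 'I_J -> A) (F : 'I_L -> A) :
    (forall c, ev (rc c) = cA c%:C%C) -> (forall f, ev (nrm f) = cA (e f) * f) ->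
    (\sum_i rc (d i) * nrm (h i)) * (\sum_j rc (d' j) * nrm (h' j)) =
      \sum_k nrm (F k) ->
  (\sum_i cA ((d i)%:C%C * e (h i)) * h i) *
    (\sum_j cA ((d' j)%:C%C * e (h' j)) * h' j) = \sum_k cA (e (F k)) * F k.
Proof.
move=> evc evN E; have := congr1 ev E; rewrite rmorphM !rmorph_sum.
have T m (a : 'I_m -> R) (g : 'I_m -> A) : \sum_i ev (rc (a i) * nrm (g i)) =
    \sum_i cA ((a i)%:C%C * e (g i)) * g i.
  by apply: eq_bigr => i _; rewrite rmorphM evc evN mulrA rmorphM.
rewrite !T => ->; apply: eq_bigr => k _; exact: evN.
Qed.

Definition hform r I := exists (d : 'I_I -> R) (h : 'I_I -> A), r = \sum_i rc (d i) * nrm (h i).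

Lemma hform_cat r r' I J : hform r I -> hform r' J -> hform (r + r') (I + J).
Proof.
move=> [d [h ->]] [d' [h' ->]].
exists (fun i => match split i with inl j => d j | inr j => d' j end),
  (fun i => match split i with inl j => h j | inr j => h' j end).
by rewrite -sum_split; apply: eq_bigr => i _; case: (split i).
Qed.

(** The identity [Re (f gbar) = |f + g|^2 / 4 - |f - g|^2 / 4]. *)
Lemma hform_hdot f g :
  hform (rc 2^-1 * (hol f * star (hol g) + star (hol f * star (hol g)))) 2.
Proof.
exists (fun i => if i == 0 then 4^-1 else - 4^-1), (fun i => if i == 0 then f + g else f - g).
rewrite !big_ord_recl big_ord0 /= addr0 rmorphN mulNr.
have -> : rc 2^-1 = rc 4^-1 + rc 4^-1 by rewrite -rmorphD; congr (rc _); field.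
by rewrite /hnorm !rmorphM !starK !rmorphB !rmorphD /=; ring.
Qed.

(** The spectral theorem: the real coefficients are the eigenvalues, and a unitary matrix transforms
    the [f k]. *)
Lemma hermitian_matrix_hform m (H : 'M[R[i]]_m) (f : 'I_m -> A) : H \is hermsymmx ->
  hform (\sum_k \sum_l cZ (H k l) * (hol (f k) * star (hol (f l)))) m.
Proof.
move=> hH; have /orthomx_spectralP HE := hermitian_normalmx hH.
set P := spectralmx H in HE; set D := spectral_diag H in HE.
have Dreal e : D 0 e \is Num.real by apply/mxOverP/hermitian_spectral_diag_real.
exists (fun e => complex.Re (D 0 e)), (fun e => \sum_k cA (P e k)^* * f k).
have PV : invmx P = map_mx Num.conj P^T by rewrite invmx_unitary ?spectral_unitarymx // map_trmx.
have Hkl k l : H k l = \sum_e (P e k)^* * D 0 e * P e l.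
  rewrite {1}HE PV mul_mx_diag mxE; apply: eq_bigr => e _.
  by rewrite !mxE.
have holS e : hol (\sum_k cA (P e k)^* * f k) = \sum_k cZ (P e k)^* * hol (f k).
  by rewrite rmorph_sum; apply: eq_bigr => k _; rewrite rmorphM hol_cA.
have starS e : star (\sum_k cZ (P e k)^* * hol (f k)) = \sum_k cZ (P e k) * star (hol (f k)).
  by rewrite rmorph_sum; apply: eq_bigr => k _; rewrite rmorphM star_cZ conjCK.
transitivity (\sum_e cZ (D 0 e) * ((\sum_k cZ (P e k)^* * hol (f k)) *
    (\sum_l cZ (P e l) * star (hol (f l))))).
  under eq_bigr do under eq_bigr do rewrite Hkl rmorph_sum mulr_suml.
  under eq_bigr do rewrite exchange_big /=.
  rewrite exchange_big /=; apply: eq_bigr => e _.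
  rewrite mulr_suml mulr_sumr; apply: eq_bigr => k _.
  rewrite !mulr_sumr; apply: eq_bigr => l _.
  by rewrite !rmorphM; ring.
apply: eq_bigr => e _; rewrite /hnorm holS starS; congr (_ * _).
by rewrite rcE RRe_real.
Qed.

(* In a representation of minimal length the [h i] are independent: a linear
   relation turns the form into a Hermitian form in one vector less, which is
   then diagonalised. *)
Lemma hform_free r I : hform r I -> exists J (d : 'I_J -> R) (h : 'I_J -> A),
  [/\ r = \sum_i rc (d i) * nrm (h i), forall i, d i != 0 &
    forall a, \sum_i cA (a i) * h i = 0 -> forall i, a i = 0].
Proof.
move=> hI; have [J [[d [h rE]] Jmin]] : exists J, hform r J /\ forall k, hform r k -> (J <= k)%N.
  have [|J /asboolP hJ Jmin] := @ex_minnP (fun k => `[< hform r k >]).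
    by exists I; apply/asboolP.
  by exists J; split=> // k /asboolP /Jmin.
exists J, d, h; case: J d h rE Jmin => [|J] d h rE Jmin; first by split=> [||a _]; [exact: rE|case|case].
have short : ~ hform r J by move=> /Jmin; rewrite ltnn.
split=> // [j|a aE j].
  apply/eqP => dj; apply: short; exists (d \o lift j), (h \o lift j).
  by rewrite rE (bigD1_ord j) //= dj rmorph0 mul0r add0r.
apply/eqP; rewrite -[_ == 0]negbK; apply/negP => aj; apply: short.
pose b i := - (a (lift j i) / a j).
have hj : h j = \sum_i cA (b i) * h (lift j i).
  move: aE; rewrite (bigD1_ord j) //= => /eqP; rewrite addr_eq0 => /eqP E.
  have -> : h j = cA (a j)^-1 * (cA (a j) * h j) by rewrite mulrA -rmorphM mulVf // rmorph1 mul1r.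
  rewrite E mulrN mulr_sumr -sumrN; apply: eq_bigr => i _.
  by rewrite mulrA -rmorphM [_^-1 * _]mulrC /b rmorphN mulNr.
(* Substituting the relation for [h j] adds a rank-one Hermitian matrix to the remaining
   diagonal. *)
pose H : 'M[R[i]]_J := \matrix_(k, l)
  ((d (lift j k))%:C%C *+ (k == l) + (d j)%:C%C * b k * (b l)^*).
have hH : H \is hermsymmx.
  apply/is_hermitianmxP; rewrite expr0 scale1r; apply/matrixP => k l; rewrite !mxE.
  rewrite rmorphD rmorphMn !rmorphM /= conjCK !conj_real [l == k]eq_sym mulrAC.
  by case: eqVneq => [->|//].
have := hermitian_matrix_hform (h \o lift j) hH.
congr (hform _ _); rewrite rE (bigD1_ord j) //= addrC.
have holj : hol (h j) = \sum_k cZ (b k) * hol (h (lift j k)).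
  by rewrite hj rmorph_sum; apply: eq_bigr => k _; rewrite rmorphM hol_cA.
have starj : star (hol (h j)) = \sum_k cZ (b k)^* * star (hol (h (lift j k))).
  by rewrite holj rmorph_sum; apply: eq_bigr => k _; rewrite rmorphM star_cZ.
rewrite {2}/hnorm starj holj mulr_suml mulr_sumr -big_split; apply: eq_bigr => k _ /=.
rewrite !mulr_sumr.
under eq_bigr do rewrite mxE rmorphD mulrDl.
rewrite big_split /=; congr (_ + _).
  rewrite (bigD1 k) //= eqxx mulr1n -rcE big1 ?addr0 // => l lk.
  by rewrite eq_sym (negbTE lk) mulr0n rmorph0 mul0r.
by apply: eq_bigr => l _; rewrite !rmorphM rcE; ring.
Qed.

End HermitianForms.

(** * Restriction to a line and behaviour at infinity *)

Section TopCoef.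
Variable S : comNzRingType.

(** A formal leading coefficient: [c] may be 0. *)
Definition top_coef k (p : {poly S}) c := (size p <= k.+1)%N /\ p`_k = c.

Lemma top_coefM k l p q c e : top_coef k p c -> top_coef l q e ->
  top_coef (k + l) (p * q) (c * e).
Proof.
move=> [sp <-] [sq <-]; split; last by rewrite coefM_top.
by apply: leq_trans (size_polyMleq _ _) _; lia.
Qed.

Lemma top_coefX k p c j : top_coef k p c -> top_coef (k * j) (p ^+ j) (c ^+ j).
Proof.
move=> pc; elim: j => [|j IH]; last by rewrite mulnS !exprS; apply: top_coefM.
by rewrite muln0 !expr0; split; rewrite ?size_poly1 // coef1.
Qed.

Lemma top_coef_prod I (r : seq I) (m : I -> nat) (p : I -> {poly S}) c :
  (forall i, top_coef 1 (p i) (c i)) ->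
  top_coef (\sum_(i <- r) m i) (\prod_(i <- r) p i ^+ m i) (\prod_(i <- r) c i ^+ m i).
Proof.
move=> pc; elim: r => [|i r IH].
  by rewrite !big_nil; split; rewrite ?size_poly1 // coef1.
rewrite !big_cons; apply: top_coefM => //.
by have := top_coefX (m i) (pc i); rewrite mul1n.
Qed.

End TopCoef.

Section Line.
Variables (C K : fieldType) (iota : {rmorphism C -> K}) (n : nat).
Variables (xi : 'I_n -> K) (a : 'I_n -> C).

Definition line : {rmorphism {mpoly C[n]} -> {poly K}} :=
  sval (opaque_rmorphism (mmap (polyC \o iota) (fun i => (xi i)%:P + (iota (a i))%:P * 'X))).

Lemma lineE f : line f = mmap (polyC \o iota) (fun i => (xi i)%:P + (iota (a i))%:P * 'X) f.
Proof. exact: svalP (opaque_rmorphism _) f. Qed.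

Lemma lineZ c f : line (c *: f) = (iota c)%:P * line f.
Proof. by rewrite !lineE mmapZ. Qed.

Lemma horner_line f t : (line f).[t] = mmap iota (fun i => xi i + iota (a i) * t) f.
Proof.
rewrite lineE -horner_evalE rmorph_mmap; apply: eq_mmap => [c|i].
  by rewrite /= /horner_eval hornerC.
by rewrite /= /horner_eval hornerD hornerM !hornerC hornerX.
Qed.

Lemma coef0_line f : (line f)`_0 = mmap iota xi f.
Proof.
by rewrite -horner_coef0 horner_line; apply: eq_mmap => // i; rewrite mulr0 addr0.
Qed.

(** A monomial has degree in [t] at most its own degree, so only the homogeneous part of degree [D]
    reaches [t^D], and its coefficient there depends on the direction [a] alone. *)
Lemma line_top D f : (msize f <= D.+1)%N ->
  (size (line f) <= D.+1)%N /\ (line f)`_D = iota (pihomog mdeg D f).@[a].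
Proof.
move=> fD; rewrite lineE /mmap.
have T m : top_coef (mdeg m) (mmap1 (fun i => (xi i)%:P + (iota (a i))%:P * 'X) m)
    (\prod_i iota (a i) ^+ m i).
  rewrite mdegE; apply: top_coef_prod => i; split.
    apply: leq_trans (size_polyD _ _) _; rewrite geq_max (leq_trans (size_polyC_leq1 _)) //=.
    by rewrite mul_polyC (leq_trans (size_scale_leq _ _)) // size_polyX.
  by rewrite coefD coefC /= coefCM coefX mulr1 add0r.
have mD m : m \in msupp f -> (mdeg m <= D)%N.
  by move=> mf; rewrite -ltnS (leq_trans _ fD) // msize_mdeg_lt.
have sz m : m \in msupp f -> (size ((polyC \o iota) f@_m *
    mmap1 (fun i => (xi i)%:P + (iota (a i))%:P * 'X)%R m)%R <= (mdeg m).+1)%N.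
  move=> _; rewrite /= mul_polyC (leq_trans (size_scale_leq _ _)) //.
  by case: (T m).
split.
  rewrite big_seq; elim/big_ind: _ => [|p q sp sq|m mf]; first by rewrite size_poly0.
    by rewrite (leq_trans (size_polyD _ _)) // geq_max sp.
  by rewrite (leq_trans (sz m mf)) // ltnS mD.
rewrite coef_sum pihomogE (rmorph_sum (meval a)) (rmorph_sum iota) [RHS]big_mkcond /=.
rewrite big_seq [RHS]big_seq; apply: eq_bigr => m mf.
case: eqVneq => [<-|mneq].
  rewrite coefCM; case: (T m) => _ ->.
  rewrite mevalZ mevalX rmorphM rmorph_prod; congr (_ * _).
  by apply: eq_bigr => i _; rewrite rmorphXn.
rewrite nth_default // (leq_trans (sz m mf)) // ltn_neqAle mneq mD //.
Qed.

End Line.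

Lemma pihomog_top n (D : numDomainType) (f : {mpoly D[n]}) : f != 0 ->
  exists a, (pihomog mdeg (msize f).-1 f).@[a] != 0.
Proof.
move=> f0; apply: contrapT => H.
have top0 : pihomog mdeg (msize f).-1 f = 0.
  apply: mpoly_eval_eq0 => a; apply/eqP; rewrite -[_ == 0]negbK; apply/negP => ta.
  by apply: H; exists a.
have := congr1 (fun p => p@_(mlead f)) top0.
rewrite mcoeff0 pihomogE raddf_sum /= -(mlead_deg f0) /=.
rewrite big_mkcond (bigD1_seq (mlead f)) ?mlead_supp ?msupp_uniq //= big1 => [|m mf]; last first.
  by case: ifP => // _; rewrite mcoeffZ mcoeffX (negbTE mf) mulr0.
rewrite eqxx addr0 mcoeffZ mcoeffX eqxx mulr1 => /eqP.
by rewrite mleadc_eq0 (negbTE f0).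
Qed.

Section FormTop.
Variable R : rcfType.

Lemma form_top_ge0 I (d : 'I_I -> R) (P : 'I_I -> {poly R[i]}) N :
  (forall i, (size (P i) <= N.+1)%N) ->
  (forall s : R, 0 <= \sum_i d i * nsq (P i).[s%:C%C]) -> 0 <= \sum_i d i * nsq (P i)`_N.
Proof.
move=> sP pos; pose a i := \poly_(j < N.+1) complex.Re (P i)`_j.
pose b i := \poly_(j < N.+1) complex.Im (P i)`_j.
pose S := \sum_i d i *: (a i * a i + b i * b i).
have SE s : S.[s] = \sum_i d i * nsq (P i).[s%:C%C].
  rewrite horner_sum; apply: eq_bigr => i _.
  by rewrite hornerZ hornerD !hornerM (horner_ReIm _ (sP i)) -!expr2.
have sa i : (size (a i) <= N.+1)%N by apply: size_poly.
have sb i : (size (b i) <= N.+1)%N by apply: size_poly.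
have SN : S`_(N + N) = \sum_i d i * nsq (P i)`_N.
  rewrite coef_sum; apply: eq_bigr => i _.
  by rewrite coefZ coefD !coefM_top // !coef_poly ltnSn -!expr2.
have sS : (size S <= (N + N).+1)%N.
  apply: (leq_trans (size_sum _ _ _)); apply/bigmax_leqP => i _.
  apply: leq_trans (size_scale_leq _ _) _; apply: leq_trans (size_polyD _ _) _.
  by rewrite geq_max !size_mul_top.
rewrite -SN leNgt; apply/negP => S0.
have lS : lead_coef (- S) = - S`_(N + N).
  rewrite lead_coefN lead_coefE; congr (- S`_ _).
  have: ((N + N) < size S)%N by rewrite ltnNge; apply/negP => /leq_sizeP /(_ _ (leqnn _)) S0'; rewrite S0' ltxx in S0.
  by move=> lt; apply/eqP; rewrite eqn_leq -ltnS prednK ?(leq_ltn_trans _ lt) // sS -ltnS prednK // (leq_ltn_trans _ lt).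
have [x Sx] : exists n, forall x, x >= n -> (- S).[x] >= lead_coef (- S).
  by apply: poly_pinfty_gt_lc; rewrite lS oppr_gt0.
have := Sx x (lexx x); rewrite lS hornerN SE.
by have := pos x; move: S0; lra.
Qed.

End FormTop.

Lemma constA_scale (R : realType) n c (f : {mpoly R[i][n]}) : constA R n c * f = c *: f.
Proof. by rewrite constAE mul_mpolyC. Qed.

Lemma div_cross (K : fieldType) (x g c : K) : c != 0 -> x / g = x / c * (g / c)^-1.
Proof. by move=> c0; rewrite invf_div mulrA divfK. Qed.

(** * Positivity of the form at every place *)

Section PlaceSign.
Variables (R : realType) (n : nat) (K : fieldType).
Local Notation C := R[i].
Local Notation A := {mpoly C[n]}.
Variables (iota : {rmorphism C -> K}) (tau : {rmorphism A -> K}) (P : place iota).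
Hypothesis tau_inj : injective tau.
Hypothesis tauC : forall c, tau c%:MP = iota c.
Variables (I J L : nat) (d : 'I_I -> R) (h : 'I_I -> A) (d' : 'I_J -> R) (h' : 'I_J -> A).
Variable F : 'I_L -> A.
Hypothesis polar : forall x,
  (\sum_i ((d i)%:C%C * ((h i).@[x])^*) *: h i) *
  (\sum_j ((d' j)%:C%C * ((h' j).@[x])^*) *: h' j) = \sum_k ((F k).@[x])^* *: F k.
Hypothesis d0 : forall i, d i != 0.
Hypothesis d'0 : forall i, d' i != 0.
Hypothesis hfree : forall a, \sum_i a i *: h i = 0 -> forall i, a i = 0.
Hypothesis h'free : forall a, \sum_i a i *: h' i = 0 -> forall i, a i = 0.
Hypotheses (i0 : 'I_I) (hi0 : h i0 != 0) (j0 : 'I_J) (h'j0 : h' j0 != 0).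
Hypotheses (k0 : 'I_L) (Fk0 : F k0 != 0).
Hypothesis pos : forall z, 0 <= \sum_i d i * nsq (h i).@[z].

(* The line [xi + t a] joins the generic point [xi] at [t = 0] to a direction
   [a] at [t = oo], where the form is non-negative because [r] is. *)
Lemma place_form_gt0 : exists i1, [/\ h i1 != 0,
  forall i, val_ring P (tau (h i) / tau (h i1)) &
  0 < \sum_i d i * nsq (residue P (tau (h i) / tau (h i1)))].
Proof.
have [i1 _ i1max] := @arg_maxnP _ i0 xpredT (fun i => msize (h i)) isT.
have hi1 : h i1 != 0.
  by rewrite -msize_poly_eq0 -lt0n (leq_trans _ (i1max i0 isT)) // lt0n msize_poly_eq0.
(* [D] is the largest degree among the [h i]. The direction [a] avoids the zeros of the top part of
   [h i1], so that 1 normalises the coefficients at [t^D]. *)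
pose D := (msize (h i1)).-1.
have hD i : (msize (h i) <= D.+1)%N.
  rewrite prednK; first exact: i1max.
  by rewrite lt0n msize_poly_eq0.
have [a top0] := pihomog_top hi1.
pose Th := line iota (fun i => tau 'X_i) a.
pose p i := Th (h i).
have ThE f : (Th f)`_0 = tau f.
  rewrite coef0_line -[in RHS](comp_mpoly_id f) (rmorph_mmap tau).
  apply: eq_mmap => [c|i] /=; first by rewrite tauC.
  by rewrite tnth_mktuple.
have Th_inj : injective Th by move=> f g fg; apply: tau_inj; rewrite -!ThE fg.
have NV (E : gplace iota) c m i2 : c != 0 -> (forall i, scaled E c m (p i)) ->
    rpoly E c m (p i2) != 0 -> exists2 Q : {poly C}, Q != 0 &
    forall y, Q.[y] != 0 -> \sum_i d i * nsq (rpoly E c m (p i)).[y] != 0.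
  move=> c0 sc ri2.
  have [Q Q0 Qnz] := nonvanishing (@lineZ _ _ _ _ _ a) Th_inj polar d0 d'0 hfree h'free
    h'j0 Fk0 c0 sc ri2.
  exists Q => // y /Qnz; apply: contra => /eqP E0.
  rewrite -[X in _ == X](rmorph0 (real_complex R)) -E0 (rmorph_sum (real_complex R)).
  apply/eqP; apply: eq_bigr => i _.
  by rewrite rmorphM /= nsqE.
have pD i := line_top iota (fun i => tau 'X_i) a (hD i).
have resD i : (p i)`_D / 1 = iota (pihomog mdeg D (h i)).@[a].
  by rewrite divr1; case: (pD i).
have nD : normal P p D 1.
  split=> [|i|]; first exact: oner_neq0.
    by rewrite resD; apply: val_ring_iota.
  by exists i1; rewrite resD residue_iota.
have sD : 0 <= sg P p d D 1.
  (* The line through the origin of C^n in direction [a] has the same top coefficients, and [pos]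
     applies to its points. *)
  pose l f := line (idfun : {rmorphism C -> C}) (fun=> 0) a f.
  have lD i := line_top (idfun : {rmorphism C -> C}) (fun=> 0) a (hD i).
  rewrite /sg; under eq_bigr do rewrite resD residue_iota.
  have E i : (l (h i))`_D = (pihomog mdeg D (h i)).@[a] by case: (lD i).
  under eq_bigr do rewrite -E.
  apply: form_top_ge0 => [i|x]; first by case: (lD i).
  have := pos (fun i => a i * x%:C%C).
  suff lE i : (l (h i)).[x%:C%C] = (h i).@[fun i => a i * x%:C%C].
    by under [X in _ -> _ <= X]eq_bigr do rewrite lE.
  by rewrite horner_line; apply: eq_mmap => // j; rewrite add0r.
have p00 : (p i0)`_0 != 0 by rewrite ThE -(rmorph0 tau) (inj_eq tau_inj).
have [c nc sc] := sign_walk NV p00 nD sD (fun i => (pD i).1).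
case: (nc) => c0 Oc [i3 ri3]; have gU := residue_unit (Oc i3) ri3.
have tg0 : (p i3)`_0 != 0 by apply: contra ri3 => /eqP ->; rewrite mul0r residue0.
(* An entry of the vector replaces the normaliser found by the walk, so that the residues are those
   of the quotients [h i / h i3]. *)
have ng : normal P p 0 (p i3)`_0.
  split=> // [i|]; last by exists i3; rewrite divff // residue1 oner_neq0.
  by rewrite (div_cross _ _ c0); apply: val_ringM => //; case: gU.
have [t t0 tE] := sg_rescale d nc ng.
have sg0 : 0 < sg P p d 0 (p i3)`_0 by rewrite tE mulr_gt0.
exists i3; split=> [|i|].
- by apply: contra tg0 => /eqP g0; rewrite ThE g0 rmorph0.
- by case: ng => _ /(_ i) + _; rewrite !ThE.
by move: sg0; rewrite /sg; under eq_bigr do rewrite !ThE.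
Qed.

End PlaceSign.

(** * From a divisor of a squared norm to a quotient *)

Section Divisor.
Variables (R : realType) (n : nat) (Z : idomainType).
Local Notation C := R[i].
Local Notation A := {mpoly C[n]}.
Local Notation cA := (@constA R n).
Variables (cZ : {rmorphism C -> Z}) (rc : {rmorphism R -> Z}).
Variables (hol : {rmorphism A -> Z}) (star : {rmorphism Z -> Z}).
Hypothesis starK : involutive star.
Hypothesis star_rc : forall c, star (rc c) = rc c.
Hypothesis rcE : forall c, rc c = cZ c%:C%C.
Hypothesis hol_cA : forall c, hol (cA c) = cZ c.
Hypothesis star_cZ : forall c, star (cZ c) = cZ c^*.
Local Notation nrm := (hnorm hol star).
Hypothesis hnorm_cA : forall c, nrm (cA c) = rc (nsq c).
Hypothesis hol_real : forall c : R,
  hol (cA c%:C%C) = rc c /\ star (hol (cA c%:C%C)) = rc c.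
Hypothesis hnorm_sum_eq0 : forall s : seq A, \sum_(f <- s) nrm f = 0 ->
  forall f, f \in s -> f = 0.
Hypothesis eval_second : forall x, exists ev : {rmorphism Z -> A},
  (forall c, ev (rc c) = cA c%:C%C) /\ forall f, ev (nrm f) = cA (f.@[x])^* * f.

Lemma hform_free_scale t m : hform rc hol star t m -> exists k (d : 'I_k -> R) (h : 'I_k -> A),
  [/\ t = \sum_i rc (d i) * nrm (h i), forall i, d i != 0 &
    forall a, \sum_i a i *: h i = 0 -> forall i, a i = 0].
Proof.
move=> ht; have [k [d [h [tE d0 hf]]]] := hform_free rcE hol_cA star_cZ ht.
exists k, d, h; split=> // a a0; apply: hf; rewrite -[RHS]a0.
by apply: eq_bigr => i _; apply: constA_scale.
Qed.

Lemma hform_neq0 k (e : 'I_k -> R) (g : 'I_k -> A) t : t != 0 ->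
  t = \sum_i rc (e i) * nrm (g i) -> exists i, g i != 0.
Proof.
move=> t0 tE; apply: contrapT => ng; move/eqP: t0; apply; rewrite tE big1 // => i _.
suff -> : g i = 0 by rewrite /hnorm rmorph0 mul0r mulr0.
by apply/eqP; rewrite -[_ == 0]negbK; apply/negP => gi; apply: ng; exists i.
Qed.

Lemma polarize_scale I J L (d : 'I_I -> R) (h : 'I_I -> A) (d' : 'I_J -> R) (h' : 'I_J -> A)
    (G : 'I_L -> A) :
    (\sum_i rc (d i) * nrm (h i)) * (\sum_j rc (d' j) * nrm (h' j)) = \sum_k nrm (G k) ->
  forall x, (\sum_i ((d i)%:C%C * ((h i).@[x])^*) *: h i) *
    (\sum_j ((d' j)%:C%C * ((h' j).@[x])^*) *: h' j) = \sum_k ((G k).@[x])^* *: G k.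
Proof.
move=> E x; have [ev [evc evN]] := eval_second x.
have := polarize (e := fun f => (f.@[x])^*) evc evN E.
under eq_bigr do rewrite constA_scale.
under [X in _ * X = _ -> _]eq_bigr do rewrite constA_scale.
by under [X in _ = X -> _]eq_bigr do rewrite constA_scale.
Qed.

Lemma abstract_quotient_of_divides (r s : Z) (F : seq A) I J :
    selfadj star r -> hform rc hol star r I -> hform rc hol star s J -> r != 0 -> s != 0 ->
    (forall k (d : 'I_k -> R) (h : 'I_k -> A), r = \sum_i rc (d i) * nrm (h i) ->
      forall z, 0 <= \sum_i d i * nsq (h i).@[z]) ->
    r * s = \sum_(f <- F) nrm f ->
  exists g, [/\ sos hol star g, g != 0 & sos hol star (r * g)].
Proof.
move=> hr hI hJ r0 s0 rpos rs; apply: contrapT => nr.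
have [k [d [h [rE d0 hf]]]] := hform_free_scale hI.
have [m [d' [h' [sE d'0 hf']]]] := hform_free_scale hJ.
have [i0 hi0] := hform_neq0 r0 rE; have [j0 h'j0] := hform_neq0 s0 sE.
pose G (k : 'I_(size F)) := tnth (in_tuple F) k.
have FE : r * s = \sum_k nrm (G k) by rewrite rs big_tnth.
have FE1 : r * s = \sum_k rc 1 * nrm (G k).
  by rewrite FE; apply: eq_bigr => i _; rewrite rmorph1 mul1r.
have [k0 Gk0] := hform_neq0 (mulf_neq0 r0 s0) FE1.
have [P Ple] := nonquotient_place starK star_rc hnorm_cA hol_real hnorm_sum_eq0 hr nr rE.
rewrite rE sE in FE; have polar := polarize_scale FE.
have tinj : injective (@FracField.tofrac A).
  by move=> f g fg; apply/eqP; rewrite -tofrac_eq fg.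
have tC c : FracField.tofrac (c%:MP : A) = frac_iota cA c by rewrite -constAE.
have [i1 [g0 vg]] := place_form_gt0 P tinj tC polar d0 d'0 hf hf' hi0 h'j0 Gk0 (rpos _ _ _ rE).
by rewrite ltNge Ple.
Qed.

End Divisor.

(** * Hermitian polynomials as diagonal forms *)

Section Polynomials.
Variables (R : realType) (n : nat).
Local Notation C := R[i].
Local Notation A := {mpoly C[n]}.
Local Notation Z := {mpoly C[n + n]}.
Local Notation hol := (@hol R n).
Local Notation star := (@star R n).
Local Notation nrm := (hnorm hol star).
Local Notation rc := (@real_const R n).
Local Notation cA := (@constA R n).

Lemma mpolyX_split (m : 'X_{1..n + n}) : exists f g, 'X_[m] = hol f * star (hol g).
Proof.
exists (\prod_i 'X_i ^+ m (lshift n i)), (\prod_i 'X_i ^+ m (rshift n i)).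
rewrite mpolyXE_id big_split_ord /= !rmorph_prod; congr (_ * _); apply: eq_bigr => i _.
  by rewrite rmorphXn holX.
by rewrite !rmorphXn holX starX /swap_ord split_lshift.
Qed.

Lemma selfadj_hform r : selfadj star r -> exists I, hform rc hol star r I.
Proof.
(* A single term of a Hermitian polynomial need not be Hermitian; symmetrising lets the induction
   run over arbitrary polynomials. *)
move=> hr; have -> : r = rc 2^-1 * (r + star r).
  rewrite hr -mulr2n -(mulr_natl r 2) mulrA -(rmorph_nat rc) -rmorphM mulVf ?pnatr_eq0 //.
  by rewrite rmorph1 mul1r.
elim/mpolyind: r {hr} => [|c m p _ _ [I hI]].
  exists 0%N, (fun=> 0), (fun=> 0).
  by rewrite big_ord0 rmorph0 addr0 mulr0.
have [f [g fg]] := mpolyX_split m; exists (2 + I)%N.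
have -> : rc 2^-1 * (c *: 'X_[m] + p + star (c *: 'X_[m] + p)) =
    rc 2^-1 * (c *: 'X_[m] + star (c *: 'X_[m])) + rc 2^-1 * (p + star p).
  by rewrite rmorphD; ring.
apply: hform_cat => //.
have -> : c *: 'X_[m] = hol (c *: f) * star (hol g).
  by rewrite -!mul_mpolyC rmorphM -(@constAE R n) hol_constA constZE -mulrA fg.
exact: hform_hdot (@starK R n) _ _.
Qed.

(** The morphism keeps [z] and substitutes the conjugate of [x] for [wbar]. *)
Lemma eval_conj_exists x : exists ev : {rmorphism Z -> A},
  (forall c, ev (rc c) = cA c%:C%C) /\ forall f, ev (nrm f) = cA (f.@[x])^* * f.
Proof.
pose ev : {rmorphism Z -> A} :=
  sval (opaque_rmorphism (mmap (@mpolyC n C) (fun i => match split i with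
    inl j => 'X_j | inr j => ((x j)^*)%:MP end))).
have evE p : ev p = mmap (@mpolyC n C) (fun i => match split i with
    inl j => 'X_j | inr j => ((x j)^*)%:MP end) p.
  exact: svalP (opaque_rmorphism _) p.
clearbody ev.
have evC c : ev (constZ R n c) = cA c by rewrite evE constZE mmapC constAE.
have evl i : ev 'X_(lshift n i) = 'X_i by rewrite evE mmapX mmap1U split_lshift.
have evr i : ev 'X_(rshift n i) = ((x i)^*)%:MP by rewrite evE mmapX mmap1U split_rshift.
have evh f : ev (hol f) = f.
  rewrite holE rmorph_mmap -[RHS]comp_mpoly_id.
  apply: eq_mmap => [c|i]; first by rewrite -[LHS]/(ev c%:MP) -constZE evC constAE.
  by rewrite -[LHS]/(ev 'X_(lshift n i)) evl tnth_mktuple.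
have evs f : ev (star (hol f)) = cA (f.@[x])^*.
  rewrite holE (rmorph_mmap star) (rmorph_mmap ev).
  rewrite -[RHS]/((cA \o Num.conj) (meval x f)) /meval rmorph_mmap.
  apply: eq_mmap => [c|i].
    by rewrite -[LHS]/(ev (star c%:MP)) -constZE star_constZ evC.
  by rewrite -[LHS]/(ev (star 'X_(lshift n i))) starX /swap_ord split_lshift evr -constAE.
exists ev; split=> [c|f]; first by rewrite real_constE evC.
by rewrite /hnorm rmorphM evh evs mulrC.
Qed.

Lemma heval_form z I (d : 'I_I -> R) (h : 'I_I -> A) :
  heval (\sum_i rc (d i) * nrm (h i)) z = (\sum_i d i * nsq (h i).@[z])%:C%C.
Proof.
rewrite heval_big (rmorph_sum (real_complex R)); apply: eq_bigr => i _.
by rewrite hevalM heval_real_const heval_hnorm rmorphM /= nsqE -normCKC.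
Qed.

Lemma quotient_of_divides (r s : Z) (F : seq A) :
    selfadj star r -> selfadj star s -> r != 0 -> s != 0 ->
    (forall z, 0 <= heval r z) -> r * s = \sum_(f <- F) nrm f ->
  exists g, [/\ sos hol star g, g != 0 & sos hol star (r * g)].
Proof.
move=> hr hs r0 s0 rpos rs.
have [I hI] := selfadj_hform hr; have [J hJ] := selfadj_hform hs.
apply: (abstract_quotient_of_divides (@starK R n) (@star_real_const R n) (@real_constE R n)
  (@hol_constA R n) (@star_constZ R n) (@hnorm_constA R n) (@hol_real R n)
  (@hnorm_sum_eq0 R n) eval_conj_exists hr hI hJ r0 s0 _ rs).
by move=> k d h rE z; have := rpos z; rewrite rE heval_form ler0c.
Qed.

End Polynomials.

(** * The two inclusions *)

Section Quotients.
Variables (R : realType) (n : nat).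
Local Notation C := R[i].
Local Notation A := {mpoly C[n]}.
Local Notation Z := {mpoly C[n + n]}.
Local Notation hol := (@hol R n).
Local Notation star := (@star R n).
Local Notation nrm := (hnorm hol star).

Lemma heval_real (r : Z) z : hermitian_symmetric r -> (complex.Re (heval r z))%:C%C = heval r z.
Proof.
move=> /hermitian_symmetricP hr; apply: RRe_real.
by apply/CrealP; rewrite -heval_star hr.
Qed.

Lemma heval_neq0 (s : Z) : s != 0 -> exists z, heval s z != 0.
Proof.
move=> s0; apply: contrapT => H; move/eqP: s0; apply; apply: heval_eq0 => z.
by apply/eqP; rewrite -[_ == 0]negbK; apply/negP => sz; apply: H; exists z.
Qed.

(** A negative value at [z] would persist on a short real segment from [z] towards a point [w] with
    [s(w) != 0]. There [s] would vanish, hence on the whole line, and so at [w]. *)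
Lemma heval_ge0_dense (r s : Z) : hermitian_symmetric r -> s != 0 ->
  (forall z, heval s z != 0 -> 0 <= heval r z) -> forall z, 0 <= heval r z.
Proof.
move=> hr s0 rpos z; rewrite -heval_real // ler0c leNgt; apply/negP => rz.
have [w sw] := heval_neq0 s0.
have [v vE] : exists v : 'I_n -> C, forall j, v j = w j - z j.
  by exists (fun j => w j - z j).
pose l (p : Z) := line (idfun : {rmorphism C -> C}) (diag_pt z) (diag_pt v) p.
have lE p (t : R) : (l p).[t%:C%C] = heval p (fun j => z j + v j * t%:C%C).
  rewrite horner_line /heval; apply: eq_mmap => // i /=.
  by rewrite /diag_pt; case: (split i) => j //=; rewrite (rmorphD Num.conj) (rmorphM Num.conj) /= conj_real.
pose a := \poly_(j < size (l r)) complex.Re (l r)`_j.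
have aE t : complex.Re (heval r (fun j => z j + v j * t%:C%C)) = a.[t].
  by rewrite -lE (horner_complex _ (leqnn _)).
have l0 p : heval p (fun j => z j + v j * 0%:C%C) = heval p z.
  by apply: meval_eq => i; rewrite /diag_pt; case: (split i) => j; rewrite rmorph0 mulr0 addr0.
have a0 : a.[0] < 0 by rewrite -aE l0.
have na0 : 0 < - a.[0] by rewrite oppr_gt0.
have [e e0 ea] := poly_cont 0 a na0.
have ls0 : l s = 0.
  (* Infinitely many distinct parameters strictly between 0 and [e]. *)
  pose t k : R := e / (k%:R + 2).
  have t0 k : 0 < t k by rewrite divr_gt0 // ltr_wpDl.
  apply: (@poly_nat_eq0 _ _ (fun k => (t k)%:C%C)) => [j k|k].
    move/(@complexI R); rewrite /t => /(mulfI (lt0r_neq0 e0)) /invr_inj /addIr /eqP.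
    by rewrite eqr_nat => /eqP.
  rewrite lE; apply/eqP; rewrite -[_ == 0]negbK; apply/negP => /rpos.
  rewrite -heval_real // ler0c aE leNgt => /negP; apply.
  have : `|t k - 0| < e.
    rewrite subr0 gtr0_norm // /t ltr_pdivrMr ?ltr_wpDl // -[X in X < _]mulr1 ltr_pM2l //.
    by rewrite ltr_wpDl // ltr1n.
  by move=> /ea; rewrite ltr_norml => /andP [_]; lra.
move: sw; suff -> : heval s w = (l s).[1%:C%C] by rewrite ls0 horner0 eqxx.
rewrite lE; apply: meval_eq => i; rewrite /diag_pt.
by case: (split i) => j; rewrite vE rmorph1 mulr1 addrC subrK.
Qed.

Lemma inQ_inQ' (r : Z) : inQ r -> inQ' r.
Proof.
move=> [hr [F [G [/hasP [g Gg g0] rFG]]]].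
pose s := \sum_(f <- G) nrm f; pose t := \sum_(f <- F) nrm f.
have sE z : heval s z = sqnorm G z by exact: heval_sum.
have tE z : heval t z = sqnorm F z by exact: heval_sum.
have s0 : s != 0 by apply: contra g0 => /eqP s0; rewrite (hnorm_sum_eq0 s0 Gg).
have norm_ge0 (H : seq A) z : 0 <= sqnorm H z by apply: sumr_ge0 => f _; apply: exprn_ge0.
have rst : r * s = t.
  (* The quotient formula is silent where [G] vanishes. The difference times [s] vanishes
     everywhere, and [s] is cancelled in the polynomial ring. *)
  apply/eqP; rewrite -subr_eq0; apply/eqP/(mulIf s0); rewrite mul0r.
  apply: heval_eq0 => z; rewrite hevalM; have [sz|sz] := eqVneq (heval s z) 0.
    by rewrite sz mulr0.
  rewrite {1}/heval mevalB -!/(heval _ _) hevalM sE tE rFG -?sE //.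
  by rewrite divfK ?subrr ?mul0r // -sE.
split.
  split=> //; apply: (heval_ge0_dense hr s0) => z.
  by rewrite sE => sz; rewrite rFG // divr_ge0.
exists s, F; split; last by split=> // z; rewrite -hevalM rst.
split; last by move=> z; rewrite sE.
by apply/hermitian_symmetricP; apply: sos_selfadj; [exact: starK|exists G].
Qed.

Lemma inQ'_inQ (r : Z) : inQ' r -> inQ r.
Proof.
move=> [[hr rpos] [s [F [[hs _] [s0 rsF]]]]]; split=> //.
(* A diagonal form of 0 may have no nonzero entry to start the argument; 0 is the empty squared norm
   divided by that of 1. *)
have [r0|r0] := eqVneq r 0.
  exists [::], [:: 1]; split=> [|z _]; first by rewrite /= oner_neq0.
  by rewrite r0 /heval meval0 /sqnorm big_nil mul0r.
have rs : r * s = \sum_(f <- F) nrm f.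
  by apply: heval_inj => z; rewrite hevalM rsF heval_sum.
have [g [[G gE] g0 [H rgH]]] := quotient_of_divides (proj1 (hermitian_symmetricP r) hr)
  (proj1 (hermitian_symmetricP s) hs) r0 s0 rpos rs.
exists H, G; split.
  apply/negPn/negP => nG; move/eqP: g0; apply; rewrite gE big_seq big1 // => f Gf.
  have -> : f = 0 by apply/eqP; apply: contraNT nG => f0; apply/hasP; exists f.
  by rewrite /hnorm rmorph0 mul0r.
move=> z; rewrite -!heval_sum -gE -rgH hevalM => gz.
by rewrite mulfK.
Qed.

End Quotients.

Theorem theorem5p3 (R : realType) (n : nat) (hn : (0 < n)%N)
    (r : {mpoly Cx R[n + n]}) :
  inQ r <-> inQ' r.
Proof. by split; [exact: inQ_inQ'|exact: inQ'_inQ]. Qed.
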